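(* Let $t_0\in\mathbb{R}$, let $\ell_0,\ell_1,f\in V$ be such that $\ell_0-\ell_1\in\mathcal{P}^+_{t_0}$, suppose $f(0)(t)=0$ for a.e. $t\le t_0$, and let there exist $\kappa>0$ such that: (i) $f(v)(t)\ge 0$ for a.e. $t\le t_0$ and every $v\in C_0(\mathbb{R};[0,\kappa])$; (ii) $f(v)(t)\,\operatorname{sgn} v(t)\le q(t,\|v\|)$ for a.e. $t\ge t_0$ and every $v\in C_0(\mathbb{R};\mathbb{R})$ with $0\le v(t_0)\le\kappa$ and $-\kappa\le v(t)\le\kappa$ for $t\le t_0$, where $q\in K_{loc}([t_0,+\infty)\times\mathbb{R}_+;\mathbb{R}_+)$ is nondecreasing in the second argument and satisfies $\lim_{x\to+\infty}\frac1x\int_{t_0}^b q(s,x)\,ds=0$ for every $b>t_0$. Let, moreover, there exist $g\in L_{loc}(\mathbb{R};\mathbb{R}_+)$ and a continuous nondecreasing function $h_0:(0,+\infty)\to(0,+\infty)$ such that $$f(v)(t)\le g(t)h_0(\|v\|)\quad\text{for a.e. }t\le t_0\text{ and every } v\in C_0(\mathbb{R};[0,\kappa]),\ v\not\equiv0,$$ and $\lim_{x\to0_+}\int_x^1\frac{ds}{h_0(s)}=+\infty$. Then, for every $c\in(0,\kappa]$, there exists a global solution $u$ to $u'(t)=\ell_0(u)(t)-\ell_1(u)(t)+f(u)(t)$, $u(t_0)=c$, satisfying $u'(t)\ge0$ for a.e. $t\le t_0$ and $0<u(t)\le\kappa$ for $t\le t_0$.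
   Context: Notation. $\mathbb{R}_+=[0,+\infty)$. $C_{loc}(\mathbb{R};\mathbb{R})$ is the space of continuous functions $\mathbb{R}\to\mathbb{R}$ with the topology of uniform convergence on every compact interval. $L_{loc}(\mathbb{R};\mathbb{R})$ is the space of locally Lebesgue-integrable functions on $\mathbb{R}$ with the topology of convergence in the mean on every compact interval. For $I,D\subseteq\mathbb{R}$: $C_0(I;D)$ is the set of bounded continuous functions $I\to D$; $AC_{loc}(I;D)$ is the set of functions $I\to D$ absolutely continuous on every compact interval contained in $I$; $L_{loc}(I;\mathbb{R}_+)$ is the set of functions $I\to\mathbb{R}_+$ integrable on every compact interval contained in $I$. $\|v\|=\sup\{|v(t)|:t\in\mathbb{R}\}$. $\operatorname{sgn}$ is the sign function with $\operatorname{sgn}0=0$. $K_{loc}([t_0,+\infty)\times\mathbb{R}_+;\mathbb{R}_+)$ is the set of functions $q:[t_0,+\infty)\times\mathbb{R}_+\to\mathbb{R}_+$ such that $q(\cdot,x)$ is measurable for every $x$, $q(t,\cdot)$ is continuous for a.e. $t$, and for every compact $D\subset\mathbb{R}_+$ the function $\sup\{q(\cdot,x):x\in D\}$ is integrable on every compact subinterval of $[t_0,+\infty)$. Standing assumptions. $\ell_0,\ell_1:C_{loc}(\mathbb{R};\mathbb{R})\to L_{loc}(\mathbb{R};\mathbb{R})$ are linear continuous operators which are positive (map non-negative functions to non-negative functions). $f:C_{loc}(\mathbb{R};\mathbb{R})\to L_{loc}(\mathbb{R};\mathbb{R})$ is a continuous operator satisfying the local Carathéodory conditions: for every $r>0$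 there is $q_r\in L_{loc}(\mathbb{R};\mathbb{R}_+)$ with $|f(v)(t)|\le q_r(t)$ for a.e. $t\in\mathbb{R}$ whenever $\sup_{\mathbb{R}}|v|\le r$. If $I\subseteq\mathbb{R}$ is a closed interval, $u:I\to\mathbb{R}$ is continuous and $T:C_{loc}(\mathbb{R};\mathbb{R})\to L_{loc}(\mathbb{R};\mathbb{R})$ is a continuous operator, then $T(u):=T(\vartheta(u))$, where $\vartheta(u)$ is the extension of $u$ to $\mathbb{R}$ equal to $u(\inf I)$ to the left of $I$ (if $\inf I>-\infty$) and $u(\sup I)$ to the right of $I$ (if $\sup I<+\infty$). $T(0)$ is the value of $T$ at the zero function. For $\tau\in\mathbb{R}$, $V_\tau$ is the set of continuous operators $T:C_{loc}(\mathbb{R};\mathbb{R})\to L_{loc}(\mathbb{R};\mathbb{R})$ such that for every $\zeta\le\tau$, $T(u)(t)=T(v)(t)$ for a.e. $t\le\zeta$ whenever $u,v\in C_{loc}(\mathbb{R};\mathbb{R})$ and $u=v$ on $(-\infty,\zeta]$. $V=\bigcap_{\tau\in\mathbb{R}}V_\tau$. $\mathcal{P}^+_\tau$ is the set of linear continuous operators $\ell:C_{loc}(\mathbb{R};\mathbb{R})\to L_{loc}(\mathbb{R};\mathbb{R})$ such that $\ell(u)(t)\ge0$ for a.e. $t\le\tau$ whenever $u\in AC_{loc}((-\infty,\tau];\mathbb{R}_+)$ is nondecreasing. A global solution is a function $u:\mathbb{R}\to\mathbb{R}$ absolutely continuous on every compact interval and satisfying the equation for a.e. $t\in\mathbb{R}$.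 *)

(* Defs.v *)
From HB Require Import structures.
From mathcomp Require Import all_boot all_order all_algebra.
From mathcomp Require Import all_classical all_reals all_analysis.
Set Implicit Arguments.
Unset Strict Implicit.
Unset Printing Implicit Defensive.
Import Order.TTheory GRing.Theory Num.Theory.
Import numFieldNormedType.Exports.
Local Open Scope classical_set_scope.
Local Open Scope ring_scope.

Section Defs.
Context {R : realType}.

(* "Measurable", "integrable" and "a.e." refer to the Lebesgue sigma-algebra:
   the completed measure is used because lebesgue_measure lives on the Borel
   sets only, so that integrability for it would require Borel functions. *)
Local Notation mu := (@completed_lebesgue_measure R).

Definition Lloc (I D : set R) (f : R -> R) : Prop :=
  (forall t, I t -> D (f t)) /\
  forall a b : R, `[a, b] `<=` I -> mu.-integrable `[a, b] (EFin \o f).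

Definition abs_cont (a b : R) (u : R -> R) : Prop :=
  forall e : R, 0 < e -> exists2 d : R, 0 < d &
  forall (n : nat) (x y : 'I_n -> R),
    (forall i, a <= x i /\ x i <= y i /\ y i <= b) ->
    trivIset setT (fun i => `]x i, y i[%classic) ->
    \sum_(i < n) (y i - x i) < d ->
    \sum_(i < n) `|u (y i) - u (x i)| < e.

Definition ACloc (I D : set R) (u : R -> R) : Prop :=
  (forall t, I t -> D (u t)) /\
  forall a b : R, `[a, b] `<=` I -> abs_cont a b u.

Definition C0 (D : set R) (v : R -> R) : Prop :=
  [/\ continuous v, bounded_fun v & forall t, D (v t)].

(* Only meaningful for bounded v, as sup is 0 on unbounded sets. *)
Definition supnorm (v : R -> R) : R := sup (range (fun t => `|v t|)).

(* A map C_loc -> L_loc is represented by T : (R -> R) -> R -> R, of which only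
   the values at continuous functions matter, and these only up to a.e.
   equality: T u is a representative of the class.  Continuity is written out
   with the seminorms sup_[c, d] |.| and int_[a, b] |.|, which define the two
   topologies. *)
Definition cont_operator (T : (R -> R) -> R -> R) : Prop :=
  (forall u : R -> R, continuous u -> Lloc setT setT (T u)) /\
  (forall u : R -> R, continuous u -> forall a b e : R, 0 < e ->
   exists c d delta : R, 0 < delta /\
   forall v : R -> R, continuous v ->
     (forall t, c <= t <= d -> `|v t - u t| < delta) ->
     \int[mu]_(t in `[a, b]) `|T v t - T u t| < e).

Definition linear_operator (T : (R -> R) -> R -> R) : Prop :=
  forall (a : R) (u v : R -> R), continuous u -> continuous v ->
  {ae mu, forall t : R, T (fun s => a * u s + v s) t = a * T u t + T v t}.

Definition positive_operator (T : (R -> R) -> R -> R) : Prop :=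
  forall u : R -> R, continuous u -> (forall t, 0 <= u t) ->
  {ae mu, forall t : R, 0 <= T u t}.

Definition local_Caratheodory (T : (R -> R) -> R -> R) : Prop :=
  forall r : R, 0 < r -> exists2 qr, Lloc setT `[0, +oo[ qr &
  forall v : R -> R, C0 setT v -> supnorm v <= r ->
  {ae mu, forall t : R, `|T v t| <= qr t}.

(* theta(u) for u defined on ]-oo, tau]. *)
Definition theta_left (tau : R) (u : R -> R) : R -> R :=
  fun t => u (Num.min t tau).

Definition V_at (tau : R) (T : (R -> R) -> R -> R) : Prop :=
  cont_operator T /\
  forall zeta, zeta <= tau -> forall u v : R -> R, continuous u -> continuous v ->
  (forall t, t <= zeta -> u t = v t) ->
  {ae mu, forall t : R, t <= zeta -> T u t = T v t}.

Definition V (T : (R -> R) -> R -> R) : Prop := forall tau, V_at tau T.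

Definition Pplus (tau : R) (l : (R -> R) -> R -> R) : Prop :=
  [/\ linear_operator l, cont_operator l &
  forall u : R -> R, ACloc `]-oo, tau] `[0, +oo[ u ->
  (forall s t, s <= t -> t <= tau -> u s <= u t) ->
  {ae mu, forall t : R, t <= tau -> 0 <= l (theta_left tau u) t}].

(* The supremum over D is taken in the extended reals, since it may be infinite
   for t in a null set; it would be -oo for D = set0. *)
Definition Kloc (t0 : R) (q : R -> R -> R) : Prop :=
  [/\ forall t x : R, t0 <= t -> 0 <= x -> 0 <= q t x,
      forall x : R, 0 <= x ->
        measurable_fun (`[t0, +oo[ : set (caratheodory_type (wlength idfun)^*%mu))
          (q^~ x),
      {ae mu, forall t : R, t0 <= t -> {within `[0, +oo[, continuous (q t)}} &
      forall D : set R, compact D -> D !=set0 -> D `<=` `[0, +oo[ ->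
      forall a b : R, t0 <= a ->
        mu.-integrable `[a, b]
          (fun t => ereal_sup [set (q t x)%:E | x in D])].

Definition global_solution (l0 l1 f : (R -> R) -> R -> R) (u : R -> R) : Prop :=
  ACloc setT setT u /\
  {ae mu, forall t : R, is_derive t 1 u (l0 u t - l1 u t + f u t)}.

End Defs.

(* Main.v *)
Require Import Defs.
From HB Require Import structures.
From mathcomp Require Import all_boot all_order all_algebra.
From mathcomp Require Import all_classical all_reals all_analysis.
From mathcomp Require Import measurable_realfun.
From mathcomp Require Import ring lra.
Import Order.TTheory GRing.Theory Num.Theory.
Import numFieldNormedType.Exports.
Local Open Scope classical_set_scope.
Local Open Scope ring_scope.

(** Let F u = l0 u - l1 u + f u. The solution is obtained as a limit of solutions of
    delayed and truncated equations, and three ideas carry the proof.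

    Truncation. Before applying F at time t, clip u to [-r, r] with a radius r that
    depends on t: kappa for t <= t0, and a constant above kappa, to be chosen, on each
    interval ]t0 + n, t0 + n + 1]. The resulting operator is still continuous and causal, and
    its values are bounded by one locally integrable function
    ([truncate_causal]).

    Shooting with a delay. The equation u(t) = lam + int_a^(t-d) F(u) is solved step by
    step from left to right. By the hypotheses on l0 - l1 and f, the operator is
    nonnegative up to t0 on nondecreasing nonnegative functions, so the solution is
    nondecreasing up to t0. It depends continuously on lam, vanishes at t0 if lam = 0
    and is at least c there if lam = c; by the intermediate value theorem some lam
    gives u(t0) = c. As a tends to -oo and d to 0 these solutions stay equicontinuous
    and locally bounded, and they have a cluster point, which solves the truncated
    equation ([causal_existence]).

    Removal of the truncation, and positivity. Up to t0 the limit is nondecreasing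
    with values in [0, c], so that clipping to [-kappa, kappa] does nothing. After t0
    the sign condition gives a bound of Gronwall type for sup |u| in terms of the
    integral of q(., sup |u|) ([growth_bound]); as this integral grows sublinearly,
    sup |u| on ]-oo, t0 + n] is below a constant known in advance ([bound_radius]),
    which is chosen as the radius. Finally u has no zero up to t0: otherwise consider
    the times at which u passes the levels x0 / 2^k above its last zero. By
    u' <= (|l0(1)| + |l1(1)|) u + g h0(u), the sum over k of x0 2^-k / h0(x0 2^-k) is
    finite, which contradicts the divergence of the integral of 1/h0 at 0
    ([osgood_positive]).

    The integral equation yields the differential equation almost everywhere by the
    differentiation theorem of Lebesgue, carried over from Borel to Lebesgue
    measurable functions ([ae_is_derive_primitive]). *)

(** * Integration over compact intervals *)

Section GeneralMeasure.
Context d (T : measurableType d) (R : realType).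
Variable nu : {measure set T -> \bar R}.

Lemma Rintegral_ae_eq (D : set T) (h k : T -> R) : measurable D ->
  nu.-integrable D (EFin \o h) -> nu.-integrable D (EFin \o k) ->
  {ae nu, forall t, D t -> h t = k t} ->
  \int[nu]_(t in D) h t = \int[nu]_(t in D) k t.
Proof.
move=> mD ih ik hk; rewrite /Rintegral; congr fine.
apply: ae_eq_integral => //.
- exact: measurable_int ih.
- exact: measurable_int ik.
- by apply: filterS hk => t H /H /= ->.
Qed.

Lemma integrable_cst_finite (D : set T) (r : R) : measurable D ->
  (nu D < +oo)%E -> nu.-integrable D (EFin \o cst r).
Proof.
move=> mD Doo; apply/integrableP; split.
  by have -> : EFin \o cst r = cst r%:E :> (T -> \bar R) by [].
rewrite /= integral_cst//; have D0 := measure_ge0 nu D.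
by apply: lte_mul_pinfty => //; rewrite ?lee_fin.
Qed.

Lemma Rintegral_null (D : set T) (h : T -> R) : measurable D ->
  nu.-integrable D (EFin \o h) -> nu D = 0%E -> \int[nu]_(t in D) h t = 0.
Proof.
move=> mD ih D0; rewrite /Rintegral null_set_integral//.
exact: measurable_int ih.
Qed.

End GeneralMeasure.

Section LebesgueIntervals.
Set Implicit Arguments.
Unset Strict Implicit.
Context {R : realType}.
Local Notation mu := (@completed_lebesgue_measure R).
Implicit Types (a b c s t : R) (h k Q : R -> R).

Lemma measurable_itv_completed (i : interval R) :
  measurable ([set` i] : set (caratheodory_type (wlength idfun)^*%mu)).
Proof. by apply: sub_caratheodory; exact: measurable_itv. Qed.
Hint Resolve measurable_itv_completed : core.

Lemma completed_measure_itv (i : interval R) :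
  mu [set` i] = (if i.1 < i.2 then (i.2 : \bar R) - i.1 else 0)%E.
Proof. exact: lebesgue_measure_itv. Qed.

(** Declared explicitly because the carrier of the completed measure is the type of
    Caratheodory measurable sets, which instance search does not see through. *)
Global Instance ae_completed_filter :
  Filter (nbhs (almost_everywhere mu)) := ae_filter_ringOfSetsType mu.

Definition locint h := forall a b, mu.-integrable `[a, b] (EFin \o h).

Lemma Lloc_locint D h : Lloc setT D h -> locint h.
Proof. by move=> [_ H] a b; exact: H. Qed.

Lemma aeT (P : R -> Prop) : (forall t, P t) -> {ae mu, forall t, P t}.
Proof. by move=> H; apply: nearW. Qed.

Lemma ae_forall_nat (P : nat -> R -> Prop) :
  (forall n, {ae mu, forall t : R, P n t}) ->
  {ae mu, forall t : R, forall n, P n t}.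
Proof.
move=> H; have : mu.-negligible (\bigcup_n [set t : R | ~ P n t]).
  by apply: negligible_bigcup => n; exact: H.
by apply: negligibleS => t /= /existsNP[n Hn]; exists n.
Qed.

(** For b < a the interval is empty and the integral is 0, not minus the
    integral over [b, a]. *)
Definition Int a b h := \int[mu]_(t in `[a, b]) h t.

Lemma IntE0 a b h : b < a -> Int a b h = 0.
Proof. by move=> ba; rewrite /Int set_itv_ge ?Rintegral_set0// -leNgt bnd_simp. Qed.

Lemma Int_eq a b h k : (forall t, a <= t <= b -> h t = k t) ->
  Int a b h = Int a b k.
Proof.
by move=> H; apply: eq_Rintegral => t /set_mem /=; rewrite in_itv /= => /H.
Qed.

Lemma Int_eq_ae a b h k : locint h -> locint k ->
  {ae mu, forall t, a <= t <= b -> h t = k t} -> Int a b h = Int a b k.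
Proof.
move=> /(_ a b) ih /(_ a b) ik hk.
apply: (@Rintegral_ae_eq _ _ _ mu `[a, b] h k) => //.
Qed.

Lemma locintD h k : locint h -> locint k -> locint (fun t => h t + k t).
Proof.
move=> ih ik a b.
have -> : EFin \o (fun t => h t + k t) = ((EFin \o h) \+ (EFin \o k))%E by [].
exact: integrableD.
Qed.

Lemma locintZ r h : locint h -> locint (fun t => r * h t).
Proof.
move=> ih a b.
have -> : EFin \o (fun t => r * h t) = (fun t => r%:E * (EFin \o h) t)%E by [].
exact: integrableZl.
Qed.

Lemma locintB h k : locint h -> locint k -> locint (fun t => h t - k t).
Proof.
move=> ih ik; rewrite (_ : (fun t => _) = (fun t => h t + -1 * k t)).
  exact/locintD/locintZ.
by apply/funext => t; rewrite mulN1r.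
Qed.

Lemma locint_norm h : locint h -> locint (fun t => `|h t|).
Proof. by move=> ih a b; exact: (integrable_norm (ih a b)). Qed.

Lemma locint_cst r : locint (cst r).
Proof.
move=> a b; apply: (@integrable_cst_finite _ _ _ mu `[a, b] r) => //.
rewrite [X in (X < _)%E]completed_measure_itv /=.
by case: ifP => _; rewrite -?EFinD ltry.
Qed.

Lemma IntD a b h k : locint h -> locint k ->
  Int a b (fun t => h t + k t) = Int a b h + Int a b k.
Proof. by move=> /(_ a b) ih /(_ a b) ik; exact: RintegralD. Qed.

Lemma IntB a b h k : locint h -> locint k ->
  Int a b (fun t => h t - k t) = Int a b h - Int a b k.
Proof. by move=> /(_ a b) ih /(_ a b) ik; exact: RintegralB. Qed.

Lemma IntZ a b r h : locint h -> Int a b (fun t => r * h t) = r * Int a b h.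
Proof. by move=> /(_ a b) ih; exact: RintegralZl. Qed.

Lemma Int_cst a b r : a <= b -> Int a b (cst r) = r * (b - a).
Proof.
move=> ab; rewrite /Int Rintegral_cst//; congr (_ * _).
rewrite [X in fine X = _]completed_measure_itv /= lte_fin; case: ltP => //.
by move=> ba; apply/esym/eqP; rewrite subr_eq0 eq_le ab ba.
Qed.

Lemma Int_ge0 a b h : (forall t, a <= t <= b -> 0 <= h t) -> 0 <= Int a b h.
Proof. by move=> H; apply: Rintegral_ge0 => t /=; rewrite in_itv /= => /H. Qed.

Lemma Int_ge0_ae a b h : locint h ->
  {ae mu, forall t, a <= t <= b -> 0 <= h t} -> 0 <= Int a b h.
Proof.
move=> ih H; rewrite (@Int_eq_ae _ _ _ (fun t => `|h t|)) //.
- by apply: Int_ge0.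
- exact: locint_norm.
- by apply: filterS H => t H /H /ger0_norm.
Qed.

Lemma Int_le_ae a b h k : locint h -> locint k ->
  {ae mu, forall t, a <= t <= b -> h t <= k t} -> Int a b h <= Int a b k.
Proof.
move=> ih ik H; rewrite -subr_ge0 -IntB//; apply: Int_ge0_ae.
  exact: locintB.
by apply: filterS H => t H /H; rewrite subr_ge0.
Qed.

Lemma le_norm_Int a b h : locint h -> `|Int a b h| <= Int a b (fun t => `|h t|).
Proof. by move=> /(_ a b) ih; exact: le_normr_Rintegral. Qed.

Lemma Int_split a b c h : locint h -> a <= b -> b <= c ->
  Int a c h = Int a b h + Int b c h.
Proof.
move=> ih ab bc; rewrite /Int.
have -> : `[a, c]%classic = `[a, b]%classic `|` `]b, c]%classic :> set R.
  by rewrite -itv_bndbnd_setU// bnd_simp.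
have ibc : mu.-integrable (`[a, b]%classic `|` `]b, c]%classic) (EFin \o h).
  by rewrite -itv_bndbnd_setU//; exact: ih.
rewrite Rintegral_setU//; last first.
  apply/disj_setPS => t /= []; rewrite !in_itv/= => /andP[_ tb] /andP[].
  by rewrite ltNge tb.
congr (_ + _).
have -> : `[b, c]%classic = [set b] `|` `]b, c]%classic :> set R by rewrite setU1itv.
rewrite Rintegral_setU//.
- rewrite [X in _ = X + _](_ : _ = 0) ?add0r//.
  rewrite -set_itv1; apply: (@Rintegral_null _ _ _ mu `[b, b]) => //.
  by rewrite [LHS]completed_measure_itv /= lte_fin ltxx.
- by rewrite -set_itv1.
- by rewrite setU1itv//; exact: ih.
- by apply/disj_setPS => t /= [] ->; rewrite in_itv/= ltxx.
Qed.

Lemma Int_mono a b s t Q : locint Q -> (forall t, 0 <= Q t) ->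
  a <= s -> t <= b -> Int s t Q <= Int a b Q.
Proof.
move=> iQ Q0 as_ tb; have [st|ts] := leP s t; last first.
  by rewrite IntE0//; exact: Int_ge0.
rewrite (@Int_split a s b)//; last exact: le_trans tb.
rewrite (@Int_split s t b)//.
by rewrite addrCA lerDl addr_ge0// Int_ge0.
Qed.

(** Absolute continuity of the integral, for arbitrary measurable sets: unions of
    many small intervals are needed for the definition of [abs_cont]. *)
Lemma Int_abs_cont a b Q (e : R) : locint Q -> 0 < e -> exists2 d, 0 < d &
  forall A : set (caratheodory_type (wlength idfun)^*%mu),
    measurable A -> A `<=` `[a, b] -> (mu A < d%:E)%E ->
    \int[mu]_(t in A) `|Q t| < e.
Proof.
move=> iQ e0.
have : mu.-integrable setT (EFin \o (Q \_ `[a, b])).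
  rewrite -restrict_EFin.
  by rewrite -(@integrable_mkcond _ _ _ mu `[a, b] (EFin \o Q))//; exact: iQ.
move=> /integral_normr_continuous /(_ e e0) [d [d0 H]]; exists d => // A mA Aab muA.
apply: le_lt_trans (H _ mA muA); rewrite le_eqVlt; apply/orP; left; apply/eqP.
apply: eq_Rintegral => t /set_mem At; rewrite patchE mem_set//; exact: Aab.
Qed.

Lemma Int_small a b Q (e : R) : locint Q -> 0 < e -> exists2 d, 0 < d &
  forall s t, a <= s -> t <= b -> t - s < d -> Int s t (fun t => `|Q t|) < e.
Proof.
move=> iQ e0; have [d d0 H] := Int_abs_cont a b iQ e0; exists d => // s t as_ tb tsd.
apply: H => //.
- move=> r /=; rewrite !in_itv /= => /andP[sr rt].
  by rewrite (le_trans as_)//= (le_trans rt).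
- rewrite [X in (X < _)%E]completed_measure_itv /= lte_fin.
  by case: ifP => _; rewrite ?lte_fin// -EFinD lte_fin.
Qed.

Lemma Int_small_ge0 a b Q (e : R) : locint Q -> (forall t, 0 <= Q t) -> 0 < e ->
  exists2 d, 0 < d &
  forall s t, a <= s -> t <= b -> t - s < d -> Int s t Q < e.
Proof.
move=> iQ Q0 e0; have [d d0 H] := Int_small a b iQ e0; exists d => // s t as_ tb tsd.
rewrite (Int_eq (k := fun t => `|Q t|)); first exact: H.
by move=> r _; rewrite ger0_norm.
Qed.

(** The two integrals differ by one over [s - d, s] and one over [t - d, t],
    and both of these intervals are short. *)
Lemma Int_shift (s t : R) h (e : R) : locint h -> s <= t -> 0 < e ->
  exists2 r, 0 < r & forall d : R, 0 <= d <= 1 -> d < r ->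
    `|Int (s - d) (t - d) h - Int s t h| < e.
Proof.
move=> ih st e0; have e2 : 0 < e / 2 by rewrite divr_gt0.
have [r r0 H] := Int_small (s - 1) t ih e2.
exists r => // d /andP[d0 d1] dr.
have small x : s <= x -> x <= t -> `|Int (x - d) x h| < e / 2.
  move=> sx xt; apply: le_lt_trans (le_norm_Int _ _ ih) (H _ _ _ xt _); lra.
have [h1 h2 h3 h4] : [/\ s - 1 <= s - d, s - d <= t - d, s - d <= s & t - d <= t].
  by split; lra.
have S1 := Int_split ih h1 h2; have S2 := Int_split ih (le_trans h1 h2) h4.
have S3 := Int_split ih h1 h3; have S4 := Int_split ih (le_trans h1 h3) st.
have -> : Int (s - d) (t - d) h - Int s t h = Int (s - d) s h - Int (t - d) t h.
  apply/eqP; rewrite subr_eq addrAC eq_sym subr_eq; apply/eqP.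
  apply: (addrI (Int (s - 1) (s - d) h)).
  by rewrite !addrA -S3 -S4 -S1 -S2.
apply: le_lt_trans (ler_normB _ _) _; rewrite [ltRHS]splitr ltrD//; exact: small.
Qed.

End LebesgueIntervals.

(** * Lebesgue differentiation and absolute continuity *)

Section Transfer.
Context d1 d2 (X : measurableType d1) (Y : measurableType d2) (R : realType).
Variable phi : X -> Y.
Hypothesis mphi : measurable_fun setT phi.
Variables (m : {measure set X -> \bar R}) (n : {measure set Y -> \bar R}).
Hypothesis mn : forall A, measurable A -> n A = m (phi @^-1` A).

(** If n is the image of m by phi, then changing an integrand on an m-null set so
    that it factors through phi turns integrals for m into integrals for n. *)
Lemma Rintegral_ae_transfer (h : X -> R) (k : Y -> R) :
  m.-integrable setT (EFin \o h) -> measurable_fun setT k ->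
  {ae m, forall t, h t = k (phi t)} -> forall D, measurable D ->
  n.-integrable setT (EFin \o k) /\
  \int[m]_(t in phi @^-1` D) h t = \int[n]_(t in D) k t.
Proof.
move=> ih mk hk D mD.
have mEk := (measurable_EFinP setT k).2 mk.
have mkC := measurableT_comp mEk mphi.
have ikC : m.-integrable setT ((EFin \o k) \o phi).
  apply/integrableP; split => //.
  have /integrableP[mh] := ih.
  rewrite (@ae_eq_integral _ _ _ m setT (fun x => `|((EFin \o k) \o phi) x|%E)) //.
  - exact: measurableT_comp.
  - exact: measurableT_comp.
  - by apply: filterS hk => t H _ /=; rewrite H.
have mphiD : measurable (phi @^-1` D) by rewrite -[_ @^-1` _]setTI; exact: mphi.
have E (f : Y -> \bar R) B :
    (\int[n]_(x in B) f x = \int[pushforward m phi]_(x in B) f x)%E.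
  by apply: eq_measure_integral => A mA _; exact: mn.
split.
  have /integrableP[_] := integrable_pushforward mphi mEk ikC measurableT.
  by rewrite -E => H; apply/integrableP; split.
rewrite (@Rintegral_ae_eq _ _ _ m _ h (k \o phi))//; last 3 first.
- exact: integrableS ih.
- exact: integrableS ikC.
- by apply: filterS hk => t.
rewrite /Rintegral; congr fine.
rewrite E (integral_pushforward mphi mEk)//.
exact: integrableS ikC.
Qed.

End Transfer.

Section LebesgueDifferentiation.
Set Implicit Arguments.
Unset Strict Implicit.
Context {R : realType}.
Local Notation mu := (@completed_lebesgue_measure R).
Local Notation leb := (@lebesgue_measure R).
Local Notation CR := (caratheodory_type (wlength (R:=R) idfun)^*%mu).
Hint Resolve measurable_itv_completed : core.

(** Each of the countably many sets {h < q}, q rational, is a Borel set up to a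
    null set; these null sets lie in one Borel null set M, and setting h to 0
    on M makes all the sets {h < r} Borel. *)
Lemma borel_modification (h : R -> R) :
  measurable_fun (setT : set CR) (h : CR -> R) ->
  exists2 k : R -> R,
    measurable_fun setT (k : measurableTypeR R -> R) & {ae mu, forall t, h t = k t}.
Proof.
move=> mh.
pose q (n : nat) : R := ratr (odflt 0 (unpickle n)).
pose A n : set R := h @^-1` `]-oo, q n[.
have mA n : exists BM : set R * set R, [/\ @measurable _ (measurableTypeR R) BM.1,
     @measurable _ (measurableTypeR R) BM.2, leb BM.2 = 0%E &
     A n `\` BM.2 = BM.1 `\` BM.2].
  have : (wlength (R:=R) idfun)^*%mu.-cara.-measurable (A n).
    have := mh measurableT `]-oo, q n[%classic (measurable_itv _).
    by rewrite setTI.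
  rewrite -completed_caratheodory_measurable g_sigma_completed_algebra_genE.
  move=> [B mB [N [M [mM M0 NM]] BN]]; exists (B, M); split => //=.
  rewrite -BN; apply/seteqP; split => t /= [].
    by move=> [Bt|/NM Mt] nMt.
  by move=> Bt nMt; split => //; left.
have [BM HBM] := choice mA.
pose M := \bigcup_n (BM n).2.
have mM : @measurable _ (measurableTypeR R) M.
  by apply: bigcupT_measurable => n; have [] := HBM n.
have M0 : leb.-negligible M.
  apply: negligible_bigcup => n; have [_ mMn Mn0 _] := HBM n.
  by exists (BM n).2; split.
exists (h \_ (~` M)); last first.
  have [N [mN N0 MN]] := M0; exists N; split => //=.
    by apply: sub_caratheodory.
  move=> t /= H; apply: MN; apply: contrapT => nMt; apply: H.
  by rewrite patchE mem_set.
apply: (measurability _ (RGenInftyO.measurableE R)) => _ [_ [r ->] <-].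
rewrite setTI.
have -> : (h \_ (~` M)) @^-1` `]-oo, r[%classic =
   (if 0 < r then M else set0) `|` \bigcup_(n in [set n | q n < r]) ((BM n).1 `\` M).
  apply/seteqP; split => t /=.
    rewrite in_itv /= patchE; case: ifPn => [/set_mem nMt htr|nMt].
      right.
      have [p] := rat_in_itvoo htr; rewrite in_itv /= => /andP[hp pr].
      have qp : q (pickle p) = ratr p by rewrite /q pickleK.
      exists (pickle p) => /=; first by rewrite qp.
      have [_ _ _ E] := HBM (pickle p).
      split => //.
      have : ((BM (pickle p)).1 `\` (BM (pickle p)).2) t; last by case.
      rewrite -E; split; last by move=> ?; apply: nMt; exists (pickle p).
      by rewrite /A /= in_itv /= qp.
    by move=> /= r0; left; rewrite r0; move: nMt; rewrite notin_setE => /contrapT.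
  move=> [|[n /= qr [Bt nMt]]]; rewrite in_itv /= patchE.
    by case: ifPn => // r0 Mt; case: ifPn => // /set_mem.
  rewrite mem_set//; have [_ _ _ E] := HBM n.
  have : ((BM n).1 `\` (BM n).2) t by split => // Mt; apply: nMt; exists n.
  by rewrite -E => -[]; rewrite /A /= in_itv /= => /lt_trans /(_ qr).
apply: measurableU; first by case: ifP => _.
apply: bigcup_measurable => n _; apply: measurableD => //.
by have [] := HBM n.
Qed.


(** The identity maps the completed measure to the Lebesgue measure on Borel sets. *)
Lemma Rintegral_ae_borel (h k : R -> R) (D : set R) :
  mu.-integrable setT (EFin \o h) ->
  measurable_fun setT (k : measurableTypeR R -> R) ->
  {ae mu, forall t, h t = k t} -> @measurable _ (measurableTypeR R) D ->
  leb.-integrable setT (EFin \o k) /\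
  \int[mu]_(t in D) h t = \int[leb]_(t in D) k t.
Proof.
move=> ih mk hk mD.
have mphi : measurable_fun setT (idfun : CR -> measurableTypeR R).
  by move=> _ B mB; rewrite setTI; apply: sub_caratheodory.
exact: (@Rintegral_ae_transfer _ _ CR (measurableTypeR R) R idfun mphi mu leb
  (fun A _ => erefl) h k ih mk hk D mD).
Qed.


(** The differentiation theorem for Borel functions applies to a Borel
    modification of the restriction of h to [-n, n], for each n. *)
Lemma ae_is_derive_primitive (u h : R -> R) : locint h ->
  (forall s t, s <= t -> u t - u s = Int s t h) ->
  {ae mu, forall t : R, is_derive t 1 u (h t)}.
Proof.
move=> ih uh.
suff H (n : nat) : {ae mu, forall t : R, `|t| < n%:R -> is_derive t 1 u (h t)}.
  apply: filterS (ae_forall_nat H) => t /(_ (Num.bound t)); apply.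
  by have := archi_boundP (normr_ge0 t); rewrite /Num.bound normr_id.
pose N : R := n%:R.
pose hn := h \_ `[- N, N].
have ihn : mu.-integrable setT (EFin \o hn).
  rewrite -restrict_EFin.
  by rewrite -(@integrable_mkcond _ _ _ mu `[- N, N] (EFin \o h))//; exact: ih.
have mhn := (measurable_EFinP (setT : set CR) hn).1
  ((@measurable_int _ _ _ mu _ _) ihn).
have [k mk hk] := borel_modification mhn.
have K D mD := Rintegral_ae_borel ihn mk hk mD (D := D).
have [ik _] := K setT measurableT.
pose F0 (x : R) : R := \int[leb]_(t in [set` `]-oo, x]]) k t.
have : {ae leb, forall x : R, derivable F0 x 1 /\ derive1 F0 x = k x}.
  apply: FTC1Ny.
    move=> y; apply: integrableS ik => //.
  exact: open_integrable_locally openT ik.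
move=> [M [mM M0 MH]].
have : {ae mu, forall t, ~ M t}.
  exists M; split => //; last by move=> t /= /contrapT.
  exact: sub_caratheodory.
apply: filterS2 hk => t hkt nMt tn.
have [dF Fk] : derivable F0 t 1 /\ derive1 F0 t = k t.
  by apply: contrapT => H; apply: nMt; apply: MH.
pose F (x : R) := F0 x + u (- N).
have FE y : - N <= y <= N -> F y = u y.
  move=> /andP[Ny yN]; rewrite /F /F0 -(K _ _).2; last exact: measurable_itv.
  rewrite -Rintegral_mkcondr (_ : _ `&` _ = `[- N, y]%classic); last first.
    apply/seteqP; split => z /=; rewrite !in_itv /=.
      by move=> [-> /andP[-> _]].
    by move=> /andP[-> zy]; rewrite zy (le_trans zy yN).
  by rewrite -/(Int _ _ _) -uh// subrK.
have : is_derive t 1 F (h t).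
  have -> : h t = k t + 0.
    rewrite addr0 -hkt /hn patchE mem_set//= in_itv /=.
    by move: tn; rewrite ltr_norml => /andP[/ltW -> /ltW ->].
  rewrite -Fk derive1E /F.
  by apply: is_deriveD; exact: derivableP.
apply: near_eq_is_derive => //.
near=> y; rewrite FE// -ler_norml ltW//; near: y.
by apply: cvgr_norm_lt tn; exact: cvg_id.
Unshelve. all: by end_near. Qed.

End LebesgueDifferentiation.

Section RintegralUnion.
Context d (T : measurableType d) (R : realType).
Variable nu : {measure set T -> \bar R}.

Lemma Rintegral_bigsetU n (F : 'I_n -> set T) (h : T -> R) :
  (forall i, measurable (F i)) -> trivIset setT F ->
  nu.-integrable (\big[setU/set0]_(i < n) F i) (EFin \o h) ->
  \int[nu]_(t in \big[setU/set0]_(i < n) F i) h t =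
  \sum_(i < n) \int[nu]_(t in F i) h t.
Proof.
move=> mF tF ih; rewrite /Rintegral integral_bigsetU_EFin //; last 3 first.
- exact: index_enum_uniq.
- by apply: sub_trivIset tF.
- exact: measurable_int ih.
rewrite (eq_bigr (fun i => (fine (\int[nu]_(t in F i) (h t)%:E))%:E)) ?sumEFin//.
move=> i _; rewrite fineK//; apply: integrable_fin_num => //.
apply: integrableS ih => //; first exact: bigsetU_measurable.
by rewrite -bigcup_seq => t Fit; exists i => //=; exact: mem_index_enum.
Qed.

End RintegralUnion.

Section AbsoluteContinuity.
Set Implicit Arguments.
Unset Strict Implicit.
Context {R : realType}.
Local Notation mu := (@completed_lebesgue_measure R).
Hint Resolve measurable_itv_completed : core.

Lemma Int_oo (a b : R) (h : R -> R) : locint h ->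
  Int a b h = \int[mu]_(t in `]a, b[) h t.
Proof.
move=> ih; have [ab|] := ltP a b; last first.
  move=> ba; rewrite [RHS](_ : _ = 0); last first.
    by rewrite set_itv_ge ?Rintegral_set0// -leNgt bnd_simp.
  apply: (@Rintegral_null _ _ _ mu `[a, b]) => //.
  by rewrite [LHS]completed_measure_itv /= lte_fin ltNge ba.
have null (c : R) : \int[mu]_(t in [set c]) h t = 0.
  rewrite -set_itv1; apply: (@Rintegral_null _ _ _ mu `[c, c]) => //.
  by rewrite [LHS]completed_measure_itv /= lte_fin ltxx.
have m1 (c : R) : @measurable _ (caratheodory_type (wlength (R:=R) idfun)^*%mu) [set c].
  by rewrite -set_itv1.
rewrite /Int -(@setUitv1 _ _ (BLeft a) b true)//; last by rewrite bnd_simp ltW.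
rewrite Rintegral_setU//; last 2 first.
- by rewrite setUitv1 ?bnd_simp ?ltW//; exact: ih.
- by apply/disj_setPS => t /= [tab tb]; move: tab; rewrite tb in_itv/= ltxx andbF.
rewrite null addr0 -(@setU1itv _ _ (BLeft b) a false)//.
rewrite Rintegral_setU ?null ?add0r//.
- rewrite setU1itv ?bnd_simp//; apply: (@integrableS _ _ _ mu `[a, b]) => //.
  by move=> t /=; rewrite !in_itv /= => /andP[-> /ltW].
- by apply/disj_setPS => t /= [] ->; rewrite in_itv/= ltxx.
Qed.

(** The shift d accommodates the delayed approximations of a solution; it does no
    harm because translating the intervals keeps them disjoint and does not
    change their lengths. *)
Lemma abs_cont_primitive (a b d : R) (u Q : R -> R) : locint Q -> (forall t, 0 <= Q t) ->
  (forall s t, s <= t -> `|u t - u s| <= Int (s - d) (t - d) Q) ->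
  abs_cont a b u.
Proof.
move=> iQ Q0 uQ e e0.
have [r r0 H] := Int_abs_cont (a - d) (b - d) iQ e0.
exists r => // n x y xy tI lt_r.
pose F (i : 'I_n) : set (caratheodory_type (wlength (R:=R) idfun)^*%mu) :=
  `]x i - d, y i - d[%classic.
have mF i : measurable (F i) by exact: measurable_itv_completed.
have tF : trivIset setT F.
  apply/trivIsetP => i j _ _ ij; apply/seteqP; split => [t []|//]; rewrite /F /=.
  rewrite !in_itv/= => /andP[ti1 ti2] /andP[tj1 tj2].
  move/trivIsetP : tI => /(_ i j I I ij) E.
  suff : (`]x i, y i[ `&` `]x j, y j[)%classic (t + d) by rewrite E.
  by split; rewrite /= in_itv/= -ltrBlDr ?ti1 ?tj1 /= -ltrBrDr ?ti2.
have mD : measurable (\big[setU/set0]_(i < n) F i) by exact: bigsetU_measurable.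
have Dab : \big[setU/set0]_(i < n) F i `<=` `[a - d, b - d].
  rewrite -bigcup_seq => t [i _]; rewrite /F /= !in_itv /= => /andP[xt ty].
  have [ax [_ yb]] := xy i; apply/andP; split.
    by rewrite (le_trans _ (ltW xt))// lerD2r.
  by rewrite (le_trans (ltW ty))// lerD2r.
have lt_mu : (mu (\big[setU/set0]_(i < n) F i) < r%:E)%E.
  rewrite measure_semi_additive_ord// (eq_bigr (fun i => (y i - x i)%:E)).
    by rewrite sumEFin lte_fin.
  move=> i _; rewrite /F [LHS]completed_measure_itv /= lte_fin ltrD2r.
  have [_ [xyi _]] := xy i; case: ltP => [_|yx].
    by rewrite -EFinD; congr EFin; ring.
  have -> : x i = y i by apply/eqP; rewrite eq_le xyi yx.
  by rewrite subrr.
apply: le_lt_trans (H _ mD Dab lt_mu).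
have -> : \int[mu]_(t in \big[setU/set0]_(i < n) F i) `|Q t| =
          \int[mu]_(t in \big[setU/set0]_(i < n) F i) Q t.
  by apply: eq_Rintegral => t _; rewrite ger0_norm.
rewrite Rintegral_bigsetU//; last first.
  by apply: (@integrableS _ _ _ mu `[a - d, b - d]) => //; exact: iQ.
apply: ler_sum => i _; rewrite /F -Int_oo//; apply: uQ.
by have [_ []] := xy i.
Qed.

End AbsoluteContinuity.

(** * Equicontinuous families *)

Section Modulus.
Set Implicit Arguments.
Unset Strict Implicit.
Context {R : realType}.
Local Notation mu := (@completed_lebesgue_measure R).

Lemma continuousP_eps (u : R -> R) :
  (forall x e, 0 < e -> exists2 d, 0 < d & forall y, `|x - y| < d -> `|u x - u y| < e) ->
  continuous u.
Proof.
move=> H x; apply/cvgrPdist_lt => e /(H x)[d d0 Hd].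
by exists d.
Qed.

(** The modulus of continuity depends on Q only: it is the same for all functions
    u and all delays d in [0, 1]. *)
Lemma modulus_equicontinuous (Q : R -> R) (A B e : R) :
  locint Q -> (forall t, 0 <= Q t) -> 0 < e -> exists2 r, 0 < r &
  forall (d : R) (u : R -> R), 0 <= d <= 1 ->
    (forall s t, s <= t -> `|u t - u s| <= Int (s - d) (t - d) Q) ->
    forall s t, A <= s <= B -> A <= t <= B -> `|s - t| < r -> `|u s - u t| < e.
Proof.
move=> iQ Q0 e0; have [r r0 H] := Int_small_ge0 (A - 1) B iQ Q0 e0.
exists r => // d u d01 uQ.
suff W s t : A <= s <= B -> A <= t <= B -> s <= t -> `|s - t| < r -> `|u s - u t| < e.
  move=> s t As At; have [/W|/ltW/W] := leP s t; first by apply.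
  by rewrite distrC (distrC (u s)); apply.
move=> /andP[As sB] /andP[At tB] st str; rewrite distrC.
apply: le_lt_trans (uQ _ _ st) _.
have := str; rewrite distrC ger0_norm ?subr_ge0// => ts.
by apply: H; lra.
Qed.

Lemma modulus_continuous (Q : R -> R) (d : R) (u : R -> R) :
  locint Q -> (forall t, 0 <= Q t) -> 0 <= d <= 1 ->
  (forall s t, s <= t -> `|u t - u s| <= Int (s - d) (t - d) Q) ->
  continuous u.
Proof.
move=> iQ Q0 d01 uQ; apply: continuousP_eps => x e e0.
have [r r0 H] := modulus_equicontinuous (x - 1) (x + 1) iQ Q0 e0.
exists (Num.min 1 r) => [|y]; first by rewrite lt_min ltr01.
rewrite lt_min => /andP[xy1 xyr]; apply: (H d) => //; first by lra.
by move: xy1; rewrite ltr_norml; lra.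
Qed.

End Modulus.

Section Compactness.
Set Implicit Arguments.
Unset Strict Implicit.
Context {R : realType}.

(** A cluster point for the topology of pointwise convergence exists by the
    theorem of Tychonoff; equicontinuity upgrades the approximation on a finite
    grid to a uniform approximation on [A, B]. A cluster point suffices, so no
    subsequence has to be extracted. *)
Lemma locally_uniform_cluster (u : nat -> R -> R) (bd : R -> R) :
  (forall n t, `|u n t| <= bd t) ->
  (forall A B e, 0 < e -> exists2 r, 0 < r & forall n s t,
     A <= s <= B -> A <= t <= B -> `|s - t| < r -> `|u n s - u n t| < e) ->
  exists2 v : R -> R, continuous v &
    forall A B e (N : nat), 0 < e -> exists2 n, (N <= n)%N &
      forall t, A <= t <= B -> `|u n t - v t| < e.
Proof.
move=> ubd ueq.
have cpt := @tychonoff R (fun _ => R) (fun t => `[- bd t, bd t]%classic)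
  (fun t => @segment_compact _ _ _).
have PF : ProperFilter (u @ \oo) by apply: fmap_proper_filter.
have FA : (u @ \oo) [set f : R -> R | forall t, `[- bd t, bd t]%classic (f t)].
  by exists 0%N => // n _ t /=; rewrite in_itv /= -ler_norml.
have [v [vbd clv]] := cpt (u @ \oo) PF FA.
have pt (s : seq R) e N : 0 < e ->
    exists2 n, (N <= n)%N & forall t, t \in s -> `|u n t - v t| < e.
  move=> e0.
  have Fn : (u @ \oo) [set f | exists2 n, (N <= n)%N & f = u n].
    by exists N => // n /= Nn; exists n.
  pose V : prod_topology (fun _ : R => R) := v.
  have FF : Filter (nbhs V) by exact: nbhs_filter.
  have nv : nbhs V [set f : R -> R | forall t, t \in s -> `|f t - v t| < e].
    elim: s => [|a s IH]; first by apply: filterE => f t.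
    have na : nbhs V [set f : R -> R | `|f a - v a| < e].
      have /= := @proj_continuous R (fun _ => R) a v.
      move=> /cvgrPdist_lt /(_ e e0); apply: filterS => f /=; by rewrite distrC.
    apply: filterS2 na IH => f /= fa IH t; rewrite inE => /orP[/eqP ->//|]; exact: IH.
  have [f [[n Nn ->] /= H]] := clv _ _ Fn nv.
  by exists n.
have vcont A B e : 0 < e -> exists2 r, 0 < r & forall s t,
     A <= s <= B -> A <= t <= B -> `|s - t| < r -> `|v s - v t| < e.
  move=> e0; have e3 : 0 < e / 3 by rewrite divr_gt0.
  have [r r0 H] := ueq A B _ e3; exists r => // s t As At st.
  have [n _ Hn] := pt [:: s; t] _ 0%N e3.
  have := Hn s; have := Hn t; rewrite !inE !eqxx orbT /= => /(_ isT) h1 /(_ isT) h2.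
  have h3 := H n s t As At st.
  move: h1 h2 h3; rewrite !ltr_norml; lra.
exists v.
  apply: continuousP_eps => x e e0.
  have [r r0 H] := vcont (x - 1) (x + 1) e e0.
  exists (Num.min 1 r) => [|y]; first by rewrite lt_min ltr01.
  rewrite lt_min => /andP[xy1 xyr]; apply: H => //; first by lra.
  by move: xy1; rewrite ltr_norml; lra.
move=> A B e N e0; have e3 : 0 < e / 3 by rewrite divr_gt0.
have [r r0 Hr] := ueq A B _ e3; have [r' r'0 Hr'] := vcont A B _ e3.
pose m := Num.min r r'; have m0 : 0 < m by rewrite lt_min r0.
(* Every t in [A, B] lies less than m to the right of a point of the grid. *)
pose K := (Num.bound ((B - A) / m)).+1.
pose grid := [seq Num.min (A + i%:R * m) B | i <- iota 0 K].
have [n Nn Hn] := pt grid _ N e3; exists n => // t /andP[At tB].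
pose i := Num.truncn ((t - A) / m).
pose p := Num.min (A + i%:R * m) B.
have tAm : 0 <= (t - A) / m by rewrite divr_ge0 ?subr_ge0 // ltW.
have /andP[i1 i2] : i%:R <= (t - A) / m < i.+1%:R by exact: truncn_itv.
have i1' : A + i%:R * m <= t by rewrite -lerBrDl -ler_pdivlMr.
have i2' : t < A + i%:R * m + m.
  by move: i2; rewrite ltr_pdivrMr// -natr1 mulrDl mul1r; lra.
have pE : p = A + i%:R * m by rewrite /p min_l // (le_trans i1').
have pgrid : p \in grid.
  apply/mapP; exists i => //; rewrite mem_iota add0n leq0n /= ltnS ltnW//.
  rewrite -(ltr_nat R); apply: le_lt_trans i1 _.
  apply: (@le_lt_trans _ _ ((B - A) / m)); last first.
    by apply: archi_boundP; rewrite divr_ge0 ?subr_ge0 ?(le_trans At)// ltW.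
  by rewrite ler_pM2r ?invr_gt0// lerD2r.
have hp := Hn _ pgrid.
have Ap : A <= p <= B by rewrite pE lerDl mulr_ge0 ?(ltW m0)//= (le_trans i1').
have tp : `|t - p| < m by rewrite pE ltr_norml; lra.
move: (tp); rewrite lt_min => /andP[tpr tpr'].
have h1 := Hr n t p (introT andP (conj At tB)) Ap tpr.
have h2 := Hr' t p (introT andP (conj At tB)) Ap tpr'.
move: hp h1 h2; rewrite !ltr_norml; lra.
Qed.

End Compactness.

(** * Existence for bounded causal operators, by delayed approximation *)

Section Tonelli.
Set Implicit Arguments.
Unset Strict Implicit.
Context {R : realType}.
Local Notation mu := (@completed_lebesgue_measure R).

(** The right-hand sides to which the approximation applies: the value of F u up to
    time z is determined by u up to time z, and Q is a bound common to all u. *)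
Record causal_operator (F : (R -> R) -> R -> R) (Q : R -> R) : Prop :=
  CausalOperator {
  causal_locint : forall u : R -> R, continuous u -> locint (F u);
  causal_cont : forall u : R -> R, continuous u -> forall a b e, 0 < e ->
    exists c d r, 0 < r /\ forall v : R -> R, continuous v ->
      (forall t, c <= t <= d -> `|v t - u t| < r) ->
      Int a b (fun t => `|F v t - F u t|) < e;
  causal_eq : forall (z : R) (u v : R -> R), continuous u -> continuous v ->
    (forall t, t <= z -> u t = v t) ->
    {ae mu, forall t : R, t <= z -> F u t = F v t};
  causal_bound : forall u : R -> R, continuous u ->
    {ae mu, forall t : R, `|F u t| <= Q t} }.

(** The Picard iterates of u(t) = lam + int_a^(t-d) F(u). Because of the delay d,
    the k-th iterate is already a solution up to time a + (k+1) d. *)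
Fixpoint tonelli (F : (R -> R) -> R -> R) (a d lam : R) (k : nat) : R -> R :=
  if k is k'.+1 then fun t => lam + Int a (t - d) (F (tonelli F a d lam k'))
  else cst lam.

Variables (F : (R -> R) -> R -> R) (Q : R -> R).
Hypothesis causalF : causal_operator F Q.
Hypothesis iQ : locint Q.
Hypothesis Q0 : forall t, 0 <= Q t.

Lemma Int_causal_le u s t : continuous u -> `|Int s t (F u)| <= Int s t Q.
Proof.
move=> cu; have iF := causal_locint causalF cu.
apply: le_trans (le_norm_Int _ _ iF) _; apply: Int_le_ae => //.
  exact: locint_norm.
by apply: filterS (causal_bound causalF cu) => x H _.
Qed.

Lemma tonelli_modulus a d lam k s t : 0 <= d <= 1 -> s <= t ->
  `|tonelli F a d lam k t - tonelli F a d lam k s| <= Int (s - d) (t - d) Q.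
Proof.
move=> d01; elim: k s t => [|k IH] s t st /=.
  by rewrite subrr normr0; apply: Int_ge0.
have cu := modulus_continuous iQ Q0 d01 IH.
have iF := causal_locint causalF cu.
rewrite opprD addrACA subrr add0r.
have [ta|at_] := ltP (t - d) a.
  have sa : s - d < a by apply: le_lt_trans ta; rewrite lerD2r.
  by rewrite (@IntE0 _ a (t - d))// (@IntE0 _ a (s - d))// subrr normr0; apply: Int_ge0.
have std : s - d <= t - d by rewrite lerD2r.
have [sa|as_] := ltP (s - d) a.
  rewrite (@IntE0 _ a (s - d))// subr0; apply: le_trans (Int_causal_le _ _ cu) _.
  by apply: Int_mono => //; exact: ltW.
by rewrite (@Int_split _ a (s - d) (t - d))// addrC addKr; exact: Int_causal_le.
Qed.

Lemma tonelli_continuous a d lam k :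
  0 <= d <= 1 -> continuous (tonelli F a d lam k).
Proof.
by move=> d01; apply: (modulus_continuous iQ Q0 d01) => s t; exact: tonelli_modulus.
Qed.

(** By causality each iteration extends the interval on which two consecutive
    iterates agree by the length d of the delay. *)
Lemma tonelli_stable a d lam k t : 0 <= d <= 1 -> t <= a + k.+1%:R * d ->
  tonelli F a d lam k t = tonelli F a d lam k.+1 t.
Proof.
move=> d01; elim: k t => [|k IH] t tk.
  rewrite /= /cst; have [ta|at_] := ltP (t - d) a; first by rewrite IntE0// addr0.
  have -> : t - d = a by apply/eqP; rewrite eq_le at_ andbT; lra.
  have := Int_causal_le a a (tonelli_continuous (a := a) (lam := lam) (k := 0%N) d01).
  rewrite (@Int_eq _ a a Q (cst (Q a))); last by move=> x; rewrite -eq_le => /eqP <-.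
  by rewrite Int_cst// subrr mulr0 normr_le0 => /eqP ->; rewrite addr0.
rewrite [LHS]/= [RHS]/=; congr (_ + _).
have c1 := tonelli_continuous (a := a) (lam := lam) (k := k) d01.
have c2 := tonelli_continuous (a := a) (lam := lam) (k := k.+1) d01.
apply: Int_eq_ae.
- exact: (causal_locint causalF c1).
- exact: (causal_locint causalF c2).
apply: filterS (causal_eq causalF c1 c2 IH) => x H /andP[_ xt]; apply: H.
by apply: le_trans xt _; move: tk; rewrite -(@natr1 _ k.+1) mulrDl mul1r; lra.
Qed.

Lemma tonelli_continuous_start a d lam k A B e : 0 <= d <= 1 -> 0 < e ->
  exists2 r, 0 < r & forall lam', `|lam' - lam| < r ->
    forall t, A <= t <= B -> `|tonelli F a d lam' k t - tonelli F a d lam k t| < e.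
Proof.
move=> d01; elim: k A B e => [|k IH] A B e e0.
  by exists e.
have cu lam' := tonelli_continuous (a := a) (lam := lam') (k := k) d01.
have e2 : 0 < e / 2 by rewrite divr_gt0.
have [c [c' [r [r0 H]]]] := causal_cont causalF (cu lam) a (B - d) e2.
have [r' r'0 H'] := IH c c' r r0.
exists (Num.min (e / 2) r'); first by rewrite lt_min e2.
move=> lam'; rewrite lt_min => /andP[l1 l2] t /andP[At tB] /=.
have iF lam0 := causal_locint causalF (cu lam0).
rewrite opprD addrACA -IntB//.
apply: le_lt_trans (ler_normD _ _) _; rewrite [ltRHS]splitr ltrD//.
apply: le_lt_trans (le_norm_Int _ _ _) _; first exact: locintB.
apply: le_lt_trans (H _ (cu lam') (H' _ l2)).
apply: Int_mono => //; last by rewrite lerD2r.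
exact/locint_norm/locintB.
Qed.

(** From here on F is nonnegative up to time t0 on the nondecreasing nonnegative
    functions: this is what lets a condition at the right end t0 of a half-line
    be met by choosing the value at the left. *)
Variable t0 : R.
Hypothesis F_zero : {ae mu, forall t : R, t <= t0 -> F (fun _ => 0) t = 0}.
Hypothesis F_ge0 : forall u : R -> R, continuous u -> (forall a b, abs_cont a b u) ->
  (forall s t, s <= t -> t <= t0 -> u s <= u t) ->
  (forall t, t <= t0 -> 0 <= u t) -> {ae mu, forall t : R, t <= t0 -> 0 <= F u t}.

Lemma tonelli_nondecreasing a d lam k : 0 <= d <= 1 -> 0 <= lam ->
  (forall s t, s <= t -> t <= t0 ->
     tonelli F a d lam k s <= tonelli F a d lam k t) /\
  (forall t, t <= t0 -> lam <= tonelli F a d lam k t).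
Proof.
move=> d01 lam0; elim: k => [|k [IH1 IH2]] //=.
have cu := tonelli_continuous (a := a) (lam := lam) (k := k) d01.
have iF := causal_locint causalF cu.
have Fu : {ae mu, forall t : R, t <= t0 -> 0 <= F (tonelli F a d lam k) t}.
  apply: F_ge0 => //.
    move=> x y; apply: (abs_cont_primitive x y (d := d) iQ Q0) => s t st.
    exact: tonelli_modulus.
  by move=> t /IH2; exact: le_trans.
have Int0 x y : y <= t0 -> 0 <= Int x y (F (tonelli F a d lam k)).
  move=> yt; apply: Int_ge0_ae => //; apply: filterS Fu => z H /andP[_ zy].
  by apply: H; exact: le_trans yt.
have [d0 d1] := andP d01.
split => [s t st tt0|t tt0]; last by rewrite lerDl Int0// lerBlDr (le_trans tt0)// lerDl.
have tdt0 : t - d <= t0 by rewrite lerBlDr (le_trans tt0)// lerDl.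
rewrite lerD2l; have [sa|as_] := ltP (s - d) a; first by rewrite IntE0// Int0.
by rewrite (@Int_split _ a (s - d) (t - d))// ?lerD2r// lerDl Int0.
Qed.

Lemma tonelli_zero a d k t : 0 <= d <= 1 -> t <= t0 -> tonelli F a d 0 k t = 0.
Proof.
move=> d01; elim: k t => [|k IH] t tt0 //=.
have cu := tonelli_continuous (a := a) (lam := 0) (k := k) d01.
have [ta|at_] := ltP (t - d) a; first by rewrite IntE0// addr0.
rewrite (@Int_eq_ae _ _ _ _ (cst 0)) ?Int_cst ?mul0r ?addr0//.
- exact: (causal_locint causalF cu).
- exact: locint_cst.
have c0 : continuous (fun _ : R => 0 : R) by move=> x; exact: cvg_cst.
apply: filterS2 F_zero (causal_eq causalF cu c0 IH) => x H1 H2 /andP[_ xt].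
have xt0 : x <= t0 by case/andP: d01 => d0 _; lra.
by rewrite H2// H1.
Qed.

(** For lam = 0 the iterate is 0 at t0 and for lam = c it is at least c there, so
    the intermediate value theorem applies. *)
Lemma tonelli_shooting a d k c : 0 <= d <= 1 -> 0 <= c ->
  exists2 lam, 0 <= lam & tonelli F a d lam k t0 = c.
Proof.
move=> d01 c0.
have [||lam] := @IVT _ (fun lam => tonelli F a d lam k t0) 0 c c c0.
- apply: continuous_subspaceT; apply: continuousP_eps => x e e0.
  have [r r0 H] := tonelli_continuous_start a x k t0 t0 d01 e0.
  exists r => // y xy; rewrite distrC; apply: H; rewrite ?lexx//.
  by rewrite distrC.
- rewrite tonelli_zero// ge_min c0 /= le_max.
  by rewrite (tonelli_nondecreasing a k d01 c0).2// orbT.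
- by rewrite in_itv /= => /andP[lam0 _] E; exists lam.
Qed.

(** The start -n and the delay 1/(n+1), with sufficiently many iterations for the
    delayed equation to hold up to time n. *)
Lemma tonelli_approximation c (n : nat) : 0 <= c ->
  let d := n.+1%:R^-1 in exists u : R -> R, [/\
    forall s t, s <= t -> `|u t - u s| <= Int (s - d) (t - d) Q,
    forall s t, - n%:R <= s - d -> s <= t -> t <= n%:R ->
      u t - u s = Int (s - d) (t - d) (F u),
    u t0 = c,
    forall s t, s <= t -> t <= t0 -> u s <= u t &
    forall t, t <= t0 -> 0 <= u t].
Proof.
move=> c0 d.
have d0 : 0 < d by rewrite invr_gt0.
have d01 : 0 <= d <= 1 by rewrite ltW//= invf_le1// ler1n.
pose a : R := - n%:R; pose k := (n.+1 * (2 * n))%N.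
have [lam lam0 ut0] := tonelli_shooting a k d01 c0.
have [mono ge_lam] := tonelli_nondecreasing a k d01 lam0.
exists (tonelli F a d lam k); split => //.
- by move=> s t st; exact: tonelli_modulus.
- move=> s t as_ st tn.
  have E x : x <= n%:R ->
      tonelli F a d lam k x = lam + Int a (x - d) (F (tonelli F a d lam k)).
    move=> xn; rewrite {1}tonelli_stable//; apply: le_trans xn _.
    have : (2 * n)%:R <= k.+1%:R * d.
      rewrite ler_pdivlMr// -natrM ler_nat /k mulnC; exact: leqW.
    rewrite natrM /a; lra.
  rewrite !E//; last exact: le_trans tn.
  rewrite opprD addrACA subrr add0r (@Int_split _ a (s - d) (t - d))//.
  + by rewrite addrC addKr.
  + by apply: (causal_locint causalF); exact: tonelli_continuous.
  + by rewrite lerD2r.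
- by move=> t /ge_lam; exact: le_trans.
Qed.

(** Continuity of F turns the locally uniform approximation into convergence in
    the mean of the integrands, and the delay disappears by [Int_shift]. *)
Lemma causal_limit (w : nat -> R -> R) (d : nat -> R) (u : R -> R) (s t : R) :
  continuous u -> (forall n, continuous (w n)) -> (forall n, 0 <= d n <= 1) ->
  (forall r, 0 < r -> exists N, forall n, (N <= n)%N -> d n < r) ->
  (forall A B e (N : nat), 0 < e -> exists2 n, (N <= n)%N &
     forall x, A <= x <= B -> `|w n x - u x| < e) ->
  (exists N, forall n, (N <= n)%N ->
     w n t - w n s = Int (s - d n) (t - d n) (F (w n))) ->
  s <= t -> u t - u s = Int s t (F u).
Proof.
move=> cu cw d01 d_small wu [N1 wF] st.
have iF := causal_locint causalF cu.
apply/eqP; rewrite -subr_eq0 -normr_le0; apply/ler_addgt0Pr => e e0; rewrite add0r.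
have e4 : 0 < e / 4 by rewrite divr_gt0.
have [x [y [r [r0 Hr]]]] := causal_cont causalF cu (s - 1) t e4.
have [r' r'0 Hr'] := Int_shift iF st e4.
have [N2 HN2] := d_small _ r'0.
have re0 : 0 < Num.min r (e / 4) by rewrite lt_min r0.
have [n Nn Hn] := wu (Num.min x s) (Num.max y t) _ (maxn N1 N2) re0.
have /andP[dn0 dn1] := d01 n.
have close z : Num.min x s <= z -> z <= Num.max y t ->
    `|w n z - u z| < r /\ `|w n z - u z| < e / 4.
  by move=> h1 h2; have := Hn z; rewrite h1 h2 lt_min => /(_ isT) /andP.
have E1 : `|Int (s - d n) (t - d n) (F (w n)) - Int (s - d n) (t - d n) (F u)| < e / 4.
  have iFw := causal_locint causalF (cw n).
  rewrite -IntB//; apply: le_lt_trans (le_norm_Int _ _ _) _; first exact: locintB.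
  apply: le_lt_trans (Hr _ (cw n) _).
    apply: Int_mono => //; first exact/locint_norm/locintB.
      by rewrite lerD2l lerN2.
    by rewrite gerBl.
  by move=> z /andP[xz zy]; have [] := close z; rewrite ?ge_min ?xz ?le_max ?zy.
have E2 := Hr' _ (d01 n) (HN2 n (leq_trans (leq_maxr _ _) Nn)).
have [_ E3] := close s ltac:(by rewrite ge_min lexx orbT) ltac:(by rewrite le_max st orbT).
have [_ E4] := close t ltac:(by rewrite ge_min st orbT) ltac:(by rewrite le_max lexx orbT).
have E5 := wF n (leq_trans (leq_maxl _ _) Nn).
move: E1 E2 E3 E4; rewrite -E5 !ltr_norml ler_norml; clear; lra.
Qed.

(** Solutions starting ever further to the left with ever smaller delays are
    equicontinuous with modulus given by Q, and equal to c at t0, hence locally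
    bounded: a cluster point of them solves the equation without delay. *)
Theorem causal_existence c : 0 <= c -> exists u : R -> R, [/\
  continuous u,
  forall s t, s <= t -> u t - u s = Int s t (F u),
  u t0 = c,
  forall s t, s <= t -> t <= t0 -> u s <= u t &
  forall t, t <= t0 -> 0 <= u t].
Proof.
move=> c0; have [w Hw] := choice (fun n => tonelli_approximation n c0).
pose d (n : nat) : R := n.+1%:R^-1.
have d01 n : 0 <= d n <= 1 by rewrite invr_ge0 ler0n /= invf_le1// ler1n.
have wQ n s t : s <= t -> `|w n t - w n s| <= Int (s - d n) (t - d n) Q.
  by have [H _ _ _ _] := Hw n; exact: H.
pose bd t := c + Int (Num.min t t0 - 1) (Num.max t t0) Q.
have wbd n t : `|w n t| <= bd t.
  have [_ _ wc _ _] := Hw n; have /andP[dn0 dn1] := d01 n.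
  rewrite -[w n t](subrK (w n t0)) addrC wc; apply: le_trans (ler_normD _ _) _.
  rewrite (ger0_norm c0) lerD2l -wc.
  have [tt0|t0t] := leP t t0.
    rewrite distrC; apply: le_trans (wQ _ _ _ tt0) _; apply: Int_mono => //; lra.
  apply: le_trans (wQ _ _ _ (ltW t0t)) _; apply: Int_mono => //; lra.
have weq A B e : 0 < e -> exists2 r, 0 < r & forall n s t,
     A <= s <= B -> A <= t <= B -> `|s - t| < r -> `|w n s - w n t| < e.
  move=> e0; have [r r0 H] := modulus_equicontinuous A B iQ Q0 e0.
  by exists r => // n s t; apply: (H _ _ (d01 n)); exact: wQ.
have [u cu Hu] := locally_uniform_cluster wbd weq.
have pt s t e : 0 < e -> exists n, `|w n s - u s| < e /\ `|w n t - u t| < e.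
  move=> e0; have [n _ H] := Hu (Num.min s t) (Num.max s t) e 0%N e0.
  by exists n; split; apply: H; rewrite ge_min le_max lexx ?orbT.
exists u; split => //.
- move=> s t st; apply: (causal_limit cu _ d01 _ Hu) => //.
  + by move=> n; exact: (modulus_continuous iQ Q0 (d01 n) (wQ n)).
  + move=> r r0; exists (Num.bound r^-1) => n rn; rewrite /d -[r]invrK.
    have rV0 : 0 < r^-1 by rewrite invr_gt0.
    rewrite ltf_pV2 ?posrE// (lt_le_trans (archi_boundP (ltW rV0)))//.
    by rewrite ler_nat leqW.
  + exists (maxn (Num.bound (s - 1)) (Num.bound t)) => n; rewrite geq_max => /andP[h1 h2].
    have bN (z : R) : (Num.bound z <= n)%N -> `|z| < n%:R.
      move=> zn; apply: lt_le_trans (archi_boundP (normr_ge0 z)) _.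
      by rewrite ler_nat; apply: leq_trans zn; rewrite /Num.bound normr_id.
    have [_ wF _ _ _] := Hw n; have /andP[dn0 dn1] := d01 n; apply: wF => //.
      by have := bN _ h1; rewrite ltr_norml -/(d n); lra.
    by have := bN _ h2; rewrite ltr_norml; lra.
- apply/eqP; rewrite -subr_eq0 -normr_le0; apply/ler_addgt0Pr => e e0.
  have [n [+ _]] := pt t0 t0 e e0; have [_ _ -> _ _] := Hw n.
  by rewrite distrC add0r => /ltW.
- move=> s t st tt0; apply/ler_addgt0Pr => e e0.
  have e2 : 0 < e / 2 by rewrite divr_gt0.
  have [n [h1 h2]] := pt s t _ e2; have [_ _ _ /(_ s t st tt0) h _] := Hw n.
  by move: h1 h2; rewrite !ltr_norml; lra.
- move=> t tt0; apply/ler_addgt0Pr => e e0.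
  have [n [h1 _]] := pt t t _ e0; have [_ _ _ _ /(_ t tt0) h] := Hw n.
  by move: h1; rewrite !ltr_norml; lra.
Qed.

End Tonelli.

(** * Positivity under the Osgood condition *)

Section Osgood.
Set Implicit Arguments.
Unset Strict Implicit.
Context {R : realType}.
Local Notation mu := (@completed_lebesgue_measure R).
Local Notation CR := (caratheodory_type (wlength (R:=R) idfun)^*%mu).

Lemma lipschitz1_continuous (p : R -> R) :
  (forall x y, `|p x - p y| <= `|x - y|) -> continuous p.
Proof.
by move=> H; apply: continuousP_eps => x e e0; exists e => // y; exact: le_lt_trans.
Qed.

Lemma maxr_lipschitz1 (c x y : R) : `|Num.max x c - Num.max y c| <= `|x - y|.
Proof.
rewrite ler_norml; have := lexx `|x - y|; rewrite {1}ler_norml.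
by case: (leP x c); case: (leP y c); lra.
Qed.

Lemma minr_lipschitz1 (c x y : R) : `|Num.min x c - Num.min y c| <= `|x - y|.
Proof.
rewrite ler_norml; have := lexx `|x - y|; rewrite {1}ler_norml.
by case: (leP x c); case: (leP y c); lra.
Qed.

Lemma locint_continuous (u : R -> R) : continuous u -> locint u.
Proof.
move=> cu a b.
have mid : measurable_fun setT (idfun : CR -> measurableTypeR R).
  by move=> _ B mB; rewrite setTI; apply: sub_caratheodory.
have mu_ : measurable_fun setT (u : measurableTypeR R -> R).
  exact: continuous_measurable_fun.
have mu' := measurableT_comp mu_ mid.
apply: (@measurable_bounded_integrable _ CR R mu).
- exact: measurable_itv_completed.
- rewrite [X in (X < _)%E]completed_measure_itv /=.
  by case: ifP => _; rewrite -?EFinD ltry.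
- exact: measurable_funTS mu'.
- have cuw : {within `[a, b], continuous u} by exact: continuous_subspaceT.
  have := continuous_compact cuw (@segment_compact _ a b).
  move=> /compact_bounded [M [_ mrt]].
  by exists M; split; rewrite ?num_real // => ? ? ? ?; exact: mrt.
Qed.

(** W k is the integral of w from z to a time T k at which u is x0 / 2^k. From
    T (k+1) to T k the function u grows by half of its value x k at T k, and
    this is at most (x k + h0 (x k)) (W k - W (k+1)). As W k <= 1/4, the term with
    x k takes at most half of that growth, so that x k / 4 is left to be bounded
    by h0 (x k) (W k - W (k+1)). *)
Lemma osgood_levels (w h0 u : R -> R) (z r : R) :
  locint w -> (forall t : R, 0 <= w t) -> continuous u ->
  z <= r -> (forall s t : R, s <= t -> t <= r -> u s <= u t) ->
  u z = 0 -> 0 < u r -> Int z r w <= 1 / 4 ->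
  (forall x : R, 0 < x -> 0 < h0 x) ->
  (forall s t : R, z <= s -> s <= t -> t <= r -> 0 < u t ->
     u t - u s <= (u t + h0 (u t)) * Int s t w) ->
  forall x0, 0 < x0 <= u r -> exists W : nat -> R,
    (forall k, 0 <= W k <= 1 / 4) /\
    forall k, (x0 / 2 ^+ k) / h0 (x0 / 2 ^+ k) <= 4 * (W k - W k.+1).
Proof.
move=> iw w0 cu zr mono uz ur Iw h0_gt0 uw x0 /andP[x00 x0r].
pose x k := x0 / 2 ^+ k.
have x_gt0 k : 0 < x k by rewrite divr_gt0// exprn_gt0.
have xS k : x k.+1 = x k / 2 by rewrite /x exprS invfM mulrA mulrAC.
have xle k : x k <= x0.
  by rewrite ler_pdivrMr ?exprn_gt0// ler_peMr ?(ltW x00)// exprn_ege1// ler1n.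
have /choice [T HT] (k : nat) : exists t : R, z <= t <= r /\ u t = x k.
  have [||t] := @IVT _ u z r (x k) zr.
  - exact: continuous_subspaceT.
  - by rewrite ge_min le_max uz (ltW (x_gt0 k)) (le_trans (xle k) x0r) orbT.
  - by rewrite in_itv /= => tzr E; exists t.
have TS k : T k.+1 <= T k.
  have [/andP[_ h1] h2] := HT k; have [/andP[_ h3] h4] := HT k.+1.
  rewrite leNgt; apply/negP => /ltW h; have := mono _ _ h h3.
  by rewrite h2 h4 xS; have := x_gt0 k; lra.
exists (fun k => Int z (T k) w); split => k.
  have [/andP[h1 h2] _] := HT k; rewrite Int_ge0//=; apply: le_trans Iw.
  exact: Int_mono.
have [/andP[h1 h2] h3] := HT k; have [/andP[h4 h5] h6] := HT k.+1.
have S := @Int_split _ z (T k.+1) (T k) w iw h4 (TS k).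
have := uw (T k.+1) (T k) h4 (TS k) h2; rewrite h3 h6 xS => /(_ (x_gt0 k)).
rewrite ler_pdivrMr; last exact: (h0_gt0 _ (x_gt0 k)).
have le1 : Int (T k.+1) (T k) w <= 1 / 4 by apply: le_trans Iw; exact: Int_mono.
have ge0 : 0 <= Int (T k.+1) (T k) w by exact: Int_ge0.
rewrite -/(x k); set J := Int (T k.+1) (T k) w in S le1 ge0 *.
have hx := h0_gt0 _ (x_gt0 k).
have XJ : x k * J <= x k * (1 / 4) by exact: (ler_wpM2l (ltW (x_gt0 k)) le1).
rewrite S -/(x k) mulrDl; move: (x k) hx XJ => X hx XJ; lra.
Qed.

(** Since h0 is nondecreasing, the integral of 1/h0 over a dyadic interval is at
    most x / h0 x at its left end x, and these quantities telescope into W. *)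
Lemma osgood_integral (h0 : R -> R) (x0 : R) (W : nat -> R) : 0 < x0 <= 1 ->
  (forall x : R, 0 < x -> 0 < h0 x) -> {within `]0, +oo[, continuous h0} ->
  (forall x y : R, 0 < x -> x <= y -> h0 x <= h0 y) ->
  (forall k, 0 <= W k <= 1 / 4) ->
  (forall k, (x0 / 2 ^+ k) / h0 (x0 / 2 ^+ k) <= 4 * (W k - W k.+1)) ->
  forall n, Int (x0 / 2 ^+ n) 1 (fun s => (h0 s)^-1) <=
    1 + Int x0 1 (fun s => (h0 s)^-1).
Proof.
move=> /andP[x00 x01] h0_gt0 h0_cont h0_mono W01 HW n.
pose x k := x0 / 2 ^+ k.
have x_gt0 k : 0 < x k by rewrite divr_gt0// exprn_gt0.
have xS k : x k.+1 = x k / 2 by rewrite /x exprS invfM mulrA mulrAC.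
have xle k : x k <= x0.
  by rewrite ler_pdivrMr ?exprn_gt0// ler_peMr ?(ltW x00)// exprn_ege1// ler1n.
have xmono k m : (k <= m)%N -> x m <= x k.
  by move=> km; rewrite ler_pM2l// lef_pV2 ?posrE ?exprn_gt0// ler_eXn2l// ltr1n.
(* 1/h0 may fail to be integrable near 0; h1 is continuous on the whole line
   and agrees with 1/h0 above x n. *)
pose h1 s := (h0 (Num.max s (x n)))^-1.
have maxp s : 0 < Num.max s (x n) by rewrite lt_max x_gt0 orbT.
have ch1 : continuous h1.
  have ch0 (y : R) : 0 < y -> h0 @ y --> h0 y.
    move=> y0; have /subspace_continuousP /(_ y) := h0_cont.
    rewrite /= in_itv /= y0 => /(_ isT); rewrite within_interior//.
    apply: open_nbhs_nbhs; split; first exact: interval_open.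
    by rewrite /= in_itv /= y0.
  move=> s; apply: cvgV; first by rewrite gt_eqF// h0_gt0.
  apply: (@cvg_comp _ _ _ (fun s => Num.max s (x n)) h0 _ (nbhs (Num.max s (x n)))).
    exact: (@lipschitz1_continuous (fun s => Num.max s (x n)) (maxr_lipschitz1 _) s).
  exact: ch0.
have ih1 := locint_continuous ch1.
have h1E a b : x n <= a -> Int a b (fun s => (h0 s)^-1) = Int a b h1.
  move=> na; apply: Int_eq => t /andP[at_ _]; rewrite /h1 max_l//; exact: le_trans at_.
rewrite -/(x n) (h1E (x n) 1 (lexx _)) (h1E x0 1 (xle n)).
rewrite (Int_split ih1 (xle n) x01).
rewrite lerD2r.
suff H k : (k <= n)%N -> Int (x k) x0 h1 <= 4 * (W 0%N.+1 - W k.+1).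
  apply: le_trans (H n (leqnn n)) _.
  by have /andP[a1 b1] := W01 1%N; have /andP[a2 b2] := W01 n.+1; lra.
elim: k => [_|k IH kn].
  rewrite /x expr0 divr1 subrr mulr0 (@Int_eq _ _ _ h1 (cst (h1 x0))).
    by rewrite Int_cst// subrr mulr0.
  by move=> t; rewrite -eq_le => /eqP <-.
have kx : x k.+1 <= x k by exact: xmono.
rewrite (@Int_split _ _ (x k))//.
have := IH (ltnW kn); have := HW k.+1; rewrite -/(x k.+1).
have : Int (x k.+1) (x k) h1 <= (h0 (x k.+1))^-1 * (x k - x k.+1).
  rewrite -Int_cst//; apply: Int_le_ae => //; first exact: locint_cst.
  apply: aeT => t /andP[kt _]; rewrite /h1 /cst max_l; last first.
    exact: le_trans (xmono _ _ kn) kt.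
  rewrite lef_pV2 ?posrE ?h0_gt0//; first exact: h0_mono.
  exact: lt_le_trans kt.
have -> : x k - x k.+1 = x k.+1 by rewrite xS; lra.
rewrite mulrC; lra.
Qed.

(** If u is 0 at z, then it is 0 as long as the integral of w from z does not
    exceed 1/4, for otherwise the two lemmas above bound the integral of 1/h0
    near 0. Finitely many such steps lead from a zero of u to t0. *)
Lemma osgood_positive (w h0 u : R -> R) (t0 : R) :
  locint w -> (forall t : R, 0 <= w t) -> continuous u ->
  (forall s t : R, s <= t -> t <= t0 -> u s <= u t) ->
  (forall t : R, t <= t0 -> 0 <= u t) -> 0 < u t0 ->
  (forall x : R, 0 < x -> 0 < h0 x) -> {within `]0, +oo[, continuous h0} ->
  (forall x y : R, 0 < x -> x <= y -> h0 x <= h0 y) ->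
  \int[mu]_(s in `[x, 1]) (h0 s)^-1 @[x --> 0^'+] --> +oo ->
  (forall s t : R, s <= t -> t <= t0 -> 0 < u t ->
     u t - u s <= (u t + h0 (u t)) * Int s t w) ->
  forall t, t <= t0 -> 0 < u t.
Proof.
move=> iw w0 cu mono u0 ut0 h0_gt0 h0_cont h0_mono h0_div uw.
have core z r : z <= r -> r <= t0 -> u z = 0 -> Int z r w <= 1 / 4 -> u r = 0.
  move=> zr rt0 uz Iw; apply/eqP; apply: contrapT => /negP ur.
  have {}ur : 0 < u r by rewrite lt_def ur u0.
  have [|||W [W01 HW]] :=
    @osgood_levels w h0 u z r iw w0 cu zr _ uz ur Iw h0_gt0 _ (Num.min 1 (u r)).
  - by move=> s t st tr; apply: mono => //; exact: le_trans rt0.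
  - by move=> s t _ st tr; apply: uw => //; exact: le_trans rt0.
  - by rewrite lt_min ltr01 ur ge_min lexx orbT.
  pose x0 := Num.min 1 (u r); have x00 : 0 < x0 by rewrite lt_min ltr01.
  have x01 : x0 <= 1 by rewrite ge_min lexx.
  have x01' : 0 < x0 <= 1 by rewrite x00.
  have B := osgood_integral x01' h0_gt0 h0_cont h0_mono W01 HW.
    have /cvgryPgt /(_ (1 + Int x0 1 (fun s => (h0 s)^-1))) [dl dl0 Hdl] := h0_div.
  pose n := Num.bound dl^-1; pose x := x0 / 2 ^+ n.
  have p2 : 0 < 2 ^+ n :> R by rewrite exprn_gt0.
  have xx : 0 < x by rewrite divr_gt0.
  have xdl : x < dl.
    rewrite /x ltr_pdivrMr//; apply: le_lt_trans x01 _.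
    rewrite -ltr_pdivrMl// mulr1; have := archi_boundP (ltW _ : 0 <= dl^-1).
    rewrite invr_gt0 => /(_ dl0) /lt_le_trans; apply.
    by rewrite -natrX ler_nat ltnW// ltn_expl.
  have := Hdl x; rewrite /= sub0r normrN gtr0_norm// => /(_ xdl xx).
  by rewrite ltNge -/(Int _ _ _) B.
have c0 : 0 < 1 / 4 :> R by rewrite divr_gt0.
move=> t tt0; rewrite lt_def u0// andbT; apply/eqP => ut.
have [dl dl0 Hdl] := Int_small_ge0 t t0 iw w0 c0.
have dl2 : 0 < dl / 2 by rewrite divr_gt0.
have H k : u (Num.min (t + k%:R * (dl / 2)) t0) = 0.
  elim: k => [|k IH]; first by rewrite mul0r addr0 min_l.
  pose z := Num.min (t + k%:R * (dl / 2)) t0.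
  have kd : 0 <= k%:R * (dl / 2) by rewrite mulr_ge0// ltW.
  have tz : t <= z by rewrite le_min tt0 andbT lerDl.
  have zz : Num.min (t + k.+1%:R * (dl / 2)) t0 - z < dl.
    apply: le_lt_trans (ler_norm _) (le_lt_trans (minr_lipschitz1 _ _ _) _).
    rewrite -natr1 mulrDl mul1r opprD addrACA subrr add0r addrAC subrr add0r.
    by rewrite gtr0_norm//; lra.
  apply: (core z) => //; first 2 last.
  - by apply/ltW/Hdl => //; rewrite ge_min lexx orbT.
  - by apply: le_min2 => //; rewrite lerD2l ler_wpM2r ?(ltW dl2)// ler_nat.
  - by rewrite ge_min lexx orbT.
have := H (Num.bound ((t0 - t) / (dl / 2))); rewrite min_r; last first.
  rewrite -lerBlDl -ler_pdivrMr//; apply/ltW/archi_boundP.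
  by rewrite divr_ge0 ?subr_ge0// ltW.
by move=> E; move: ut0; rewrite E ltxx.
Qed.

End Osgood.

(** * Causal and positive operators *)

Section Operators.
Set Implicit Arguments.
Unset Strict Implicit.
Context {R : realType}.
Local Notation mu := (@completed_lebesgue_measure R).

Lemma ae_neq (s : R) : {ae mu, forall t : R, t <> s}.
Proof.
exists [set s]; split.
- by rewrite -set_itv1; exact: measurable_itv_completed.
- by rewrite -set_itv1 [LHS]completed_measure_itv /= lte_fin ltxx.
- by move=> t /= /contrapT.
Qed.

Definition volterra (T : (R -> R) -> R -> R) := forall (z : R) (u v : R -> R),
  continuous u -> continuous v -> (forall t, t <= z -> u t = v t) ->
  {ae mu, forall t : R, t <= z -> T u t = T v t}.

Implicit Types S T : (R -> R) -> R -> R.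

Lemma V_volterra T : V T -> volterra T.
Proof. by move=> VT z u v cu cv uv; have [_] := VT z; apply. Qed.

Lemma cont_operator_locint T (u : R -> R) :
  cont_operator T -> continuous u -> locint (T u).
Proof. by move=> [H _] /H /Lloc_locint. Qed.

Lemma cont_operatorD S T : cont_operator S -> cont_operator T ->
  cont_operator (fun u t => S u t + T u t).
Proof.
move=> cS cT; split => [u cu|u cu a b e e0].
  split => // a b _; apply: locintD; exact: cont_operator_locint.
have e2 : 0 < e / 2 by rewrite divr_gt0.
have [c1 [d1 [r1 [r10 H1]]]] := cS.2 u cu a b _ e2.
have [c2 [d2 [r2 [r20 H2]]]] := cT.2 u cu a b _ e2.
exists (Num.min c1 c2), (Num.max d1 d2), (Num.min r1 r2); split.
  by rewrite lt_min r10.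
move=> v cv H.
have {}H1 := H1 v cv _; have {}H2 := H2 v cv _.
have iSu := cont_operator_locint cS cu; have iSv := cont_operator_locint cS cv.
have iTu := cont_operator_locint cT cu; have iTv := cont_operator_locint cT cv.
have := ltrD (H1 _) (H2 _); rewrite -splitr => K.
apply: le_lt_trans (K _ _).
- rewrite -IntD; [|exact/locint_norm/locintB|exact/locint_norm/locintB].
  apply: Int_le_ae; first exact/locint_norm/locintB/locintD/iTu/iSu/locintD.
    by apply: locintD; exact/locint_norm/locintB.
  by apply: aeT => t _; rewrite opprD addrACA ler_normD.
- move=> t /andP[h1 h2]; have : `|v t - u t| < Num.min r1 r2.
    by apply: H; rewrite ge_min h1 le_max h2.
  by rewrite lt_min => /andP[].
- move=> t /andP[h1 h2]; have : `|v t - u t| < Num.min r1 r2.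
    by apply: H; rewrite ge_min h1 le_max h2 !orbT.
  by rewrite lt_min => /andP[].
Qed.

Lemma cont_operatorN T : cont_operator T -> cont_operator (fun u t => - T u t).
Proof.
move=> cT; split => [u cu|u cu a b e e0].
  split => // a b _; have := locintZ (-1) (cont_operator_locint cT cu).
  by move=> /(_ a b); congr (mu.-integrable _ _); apply/funext => t /=; rewrite mulN1r.
have [c [d [r [r0 H]]]] := cT.2 u cu a b e e0.
exists c, d, r; split => // v cv /(H v cv); apply: le_lt_trans.
rewrite le_eqVlt; apply/orP; left; apply/eqP; apply: Int_eq => t _.
by rewrite -opprD normrN.
Qed.

Lemma theta_left_continuous (tau : R) (u : R -> R) :
  continuous u -> continuous (theta_left tau u).
Proof.
move=> cu t; apply: (@cvg_comp _ _ _ (fun t => Num.min t tau) u _ (nbhs (Num.min t tau))).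
  exact: (@lipschitz1_continuous _ (fun t => Num.min t tau)
    (minr_lipschitz1 tau) t).
exact: cu.
Qed.

Lemma theta_leftE (tau t : R) (u : R -> R) : t <= tau -> theta_left tau u t = u t.
Proof. by move=> h; rewrite /theta_left min_l. Qed.

(** Freezing u after tau makes bounds that hold up to time tau hold everywhere, as
    positivity and the hypotheses on f require. *)
Lemma volterra_theta T (tau : R) (u : R -> R) : volterra T -> continuous u ->
  {ae mu, forall t : R, t <= tau -> T u t = T (theta_left tau u) t}.
Proof.
move=> VT cu; apply: VT => //; first exact: theta_left_continuous.
by move=> t h; rewrite theta_leftE.
Qed.

Let c1 : continuous (cst 1 : R -> R). Proof. by move=> x; exact: cvg_cst. Qed.
Let c0 : continuous (cst 0 : R -> R). Proof. by move=> x; exact: cvg_cst. Qed.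

Lemma linear_operator0 T : linear_operator T ->
  {ae mu, forall t : R, T (fun _ => 0) t = 0}.
Proof.
move=> /(_ (-1) (cst 0) (cst 0) c0 c0).
rewrite (_ : (fun s : R => -1 * cst 0 s + cst 0 s) = fun _ => 0); last first.
  by apply/funext => s; rewrite /cst mulr0 addr0.
by apply: filterS => t ->; rewrite /cst mulN1r addNr.
Qed.

Section Positive.
Variable l : (R -> R) -> R -> R.
Hypothesis l_lin : linear_operator l.
Hypothesis l_pos : positive_operator l.
Hypothesis l_V : volterra l.

Lemma positive_operator_ge0 (tau : R) (v : R -> R) : continuous v ->
  (forall t, t <= tau -> 0 <= v t) -> {ae mu, forall t : R, t <= tau -> 0 <= l v t}.
Proof.
move=> cv v0; have ct := @theta_left_continuous tau _ cv.
have /(l_pos ct) : forall t, 0 <= theta_left tau v t.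
  by move=> t; apply: v0; rewrite ge_min lexx orbT.
by apply: filterS2 (volterra_theta tau l_V cv) => t H h /H ->.
Qed.

Lemma positive_operator_le (tau m : R) (v : R -> R) : continuous v ->
  (forall t, t <= tau -> v t <= m) ->
  {ae mu, forall t : R, t <= tau -> l v t <= m * l (cst 1) t}.
Proof.
move=> cv vm.
have cm : continuous (fun s : R => m * cst 1 s + cst 0 s : R).
  by move=> x; apply: cvgD; [apply: cvgM|]; exact: cvg_cst.
have cw : continuous (fun s : R => -1 * v s + (m * cst 1 s + cst 0 s)).
  by move=> x; apply: cvgD; [apply: cvgM; [exact: cvg_cst|exact: cv]|exact: cm].
have w0 t : t <= tau -> 0 <= -1 * v t + (m * cst 1 t + cst 0 t).
  by move=> /vm; rewrite /cst; lra.
have E0 := linear_operator0 l_lin.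
have E : {ae mu, forall t : R, l (fun s => -1 * v s + (m * cst 1 s + cst 0 s)) t =
    - l v t + m * l (cst 1) t}.
  by apply: filterS3 (l_lin (-1) cv cm) (l_lin m c1 c0) E0 => t -> -> ->; lra.
by apply: filterS2 (positive_operator_ge0 cw w0) E => t H K /H; rewrite K; lra.
Qed.

Lemma positive_operator_norm (tau m : R) (v : R -> R) : continuous v ->
  (forall t, t <= tau -> `|v t| <= m) ->
  {ae mu, forall t : R, t <= tau -> `|l v t| <= m * l (cst 1) t}.
Proof.
move=> cv vm.
have cNv : continuous (fun s : R => -1 * v s + cst 0 s).
  by move=> x; apply: cvgD; [apply: cvgM; [exact: cvg_cst|exact: cv]|exact: cvg_cst].
have h1 t : t <= tau -> v t <= m by move=> /vm; rewrite ler_norml => /andP[].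
have h2 t : t <= tau -> -1 * v t + cst 0 t <= m.
  by move=> /vm; rewrite ler_norml /cst; lra.
have E0 := linear_operator0 l_lin.
have K : {ae mu, forall t : R, t <= tau -> - l v t <= m * l (cst 1) t}.
  apply: filterS3 (positive_operator_le cNv h2) (l_lin (-1) cv c0) E0 => t H E E' /H.
  by rewrite E E'; lra.
apply: filterS2 (positive_operator_le cv h1) K => t H K tt.
by move: (H tt) (K tt); rewrite ler_norml; lra.
Qed.

End Positive.

End Operators.

(** * Truncation with a radius that depends on the time *)

Lemma integrable_restrict_setI d (T : measurableType d) (R : realType)
    (nu : {measure set T -> \bar R}) (D A : set T) (h : T -> R) :
  measurable D -> measurable A -> nu.-integrable (D `&` A) (EFin \o h) ->
  nu.-integrable D (EFin \o (h \_ A)).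
Proof.
move=> mD mA ih; apply/(integrable_mkcond _ mD).
move: ih => /(integrable_mkcond _ (measurableI _ _ mD mA)).
congr (_.-integrable _ _); apply/funext => t /=.
by rewrite !patchE in_setI; case: (t \in D) => //=; rewrite patchE; case: (t \in A).
Qed.

Section Clip.
Set Implicit Arguments.
Unset Strict Implicit.
Context {R : realType}.
Implicit Types r x y : R.

Definition clip r x := Num.max (Num.min x r) (- r).

Lemma clip_lipschitz1 r x y : `|clip r x - clip r y| <= `|x - y|.
Proof. exact: le_trans (maxr_lipschitz1 _ _ _) (minr_lipschitz1 _ _ _). Qed.

Lemma clip_id r x : `|x| <= r -> clip r x = x.
Proof. by rewrite ler_norml => /andP[h1 h2]; rewrite /clip min_l// max_l. Qed.

Lemma norm_clip_le r x : 0 <= r -> `|clip r x| <= r.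
Proof.
by move=> r0; rewrite ler_norml /clip ge_max le_max ge_min !lexx !orbT/=; lra.
Qed.

Lemma clip0 r : 0 <= r -> clip r 0 = 0.
Proof. by move=> r0; rewrite clip_id// normr0. Qed.

Lemma norm_clip_le_norm r x : 0 <= r -> `|clip r x| <= `|x|.
Proof. by move=> r0; have := clip_lipschitz1 r x 0; rewrite clip0// !subr0. Qed.

Lemma clip_mono r x y : x <= y -> clip r x <= clip r y.
Proof. by move=> xy; rewrite /clip le_max2// le_min2. Qed.

Lemma clip_ge0 r x : 0 <= r -> 0 <= x -> 0 <= clip r x.
Proof. by move=> r0 x0; rewrite /clip le_max le_min x0 r0. Qed.

Lemma sgr_clip r x : 0 < r -> Num.sg (clip r x) = Num.sg x.
Proof.
move=> r0; have [x0|x0|->] := ltrgt0P x; last by rewrite clip0// ltW.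
  by rewrite !gtr0_sg// /clip lt_max lt_min x0 r0.
by rewrite !ltr0_sg// /clip gt_max gt_min x0 oppr_lt0.
Qed.

Lemma clip_comp_continuous r (u : R -> R) : continuous u -> continuous (clip r \o u).
Proof.
move=> cu x; apply: continuous_comp; first exact: cu.
exact: (lipschitz1_continuous (clip_lipschitz1 r)).
Qed.

Lemma abs_cont_clip r a b (u : R -> R) : abs_cont a b u -> abs_cont a b (clip r \o u).
Proof.
move=> H e /H[d d0 Hd]; exists d => // n x y xy tI lt_d.
by apply: le_lt_trans (Hd n x y xy tI lt_d); apply: ler_sum => i _; exact: clip_lipschitz1.
Qed.

(** The least natural number k such that t <= t0 + k; it is 0 for all t <= t0. *)
Definition stage (t0 t : R) : nat := `|Num.ceil (Num.max 0 (t - t0))%R|%N.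

Lemma stage_le (t0 t : R) k : (stage t0 t <= k)%N = (t <= t0 + k%:R).
Proof.
rewrite /stage -lez_nat gez0_abs; last first.
  by rewrite ceil_ge0 lt_max ltrN10.
by rewrite ceil_le_int ge_max ler0n /= lerBlDl.
Qed.

End Clip.

Section Truncation.
Set Implicit Arguments.
Unset Strict Implicit.
Context {R : realType}.
Local Notation mu := (@completed_lebesgue_measure R).
Local Notation CR := (caratheodory_type (wlength (R:=R) idfun)^*%mu).

Lemma measurable_stage (t0 : R) k :
  @measurable _ CR [set t | stage t0 t = k].
Proof.
case: k => [|k].
  rewrite (_ : [set _ | _] = `]-oo, t0]%classic); first exact: measurable_itv_completed.
  apply/seteqP; split => t /=; rewrite in_itv /= -[X in _ <= X]addr0;
    by rewrite -(stage_le t0 t 0) leqn0 => /eqP.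
rewrite (_ : [set _ | _] = `]t0 + k%:R, t0 + k.+1%:R]%classic).
  exact: measurable_itv_completed.
apply/seteqP; split => t /=; rewrite in_itv /= -stage_le ltNge -stage_le -ltnNge.
  by move=> ->; rewrite leqnn.
by rewrite -eqn_leq eq_sym => /eqP.
Qed.

Lemma locint_sum (H : nat -> R -> R) n : (forall k, locint (H k)) ->
  locint (fun t => \sum_(k < n) H k t).
Proof.
move=> iH; elim: n => [|n IH].
  rewrite (_ : (fun t => _) = cst 0); first exact: locint_cst.
  by apply/funext => t; rewrite big_ord0.
rewrite (_ : (fun t => _) = fun t => \sum_(k < n) H k t + H n t); first exact: locintD.
by apply/funext => t; rewrite big_ord_recr.
Qed.

Lemma locint_piecewise (t0 : R) (H : nat -> R -> R) : (forall k, locint (H k)) ->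
  locint (fun t => H (stage t0 t) t).
Proof.
move=> iH a b; pose N := stage t0 b.
pose G k := H k \_ [set t | stage t0 t = k].
have iG k : locint (G k).
  move=> x y; apply: (@integrable_restrict_setI _ CR R mu).
  - exact: measurable_itv_completed.
  - exact: measurable_stage.
  - apply: (@integrableS _ CR R mu `[x, y]) => //; try exact: measurable_itv_completed.
    by apply: measurableI; [exact: measurable_itv_completed|exact: measurable_stage].
    exact: iH.
apply: (@eq_integrable _ CR R mu `[a, b] (measurable_itv_completed _)
  (EFin \o (fun t => \sum_(k < N.+1) G k t))); last exact: locint_sum.
move=> t /set_mem /=; rewrite in_itv /= => /andP[_ tb]; congr EFin.
have tN : (stage t0 t < N.+1)%N.
  by rewrite ltnS stage_le; apply: le_trans tb _; rewrite -stage_le.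
rewrite (bigD1 (Ordinal tN)) //= big1 ?addr0 => [|i /eqP ine].
  by rewrite /G patchE mem_set.
rewrite /G patchE; case: ifPn => // /set_mem /= E.
by exfalso; apply: ine; apply/val_inj.
Qed.

(** The radius depends on the time t at which F is evaluated and not on the time at
    which u is: so the clipped function is continuous although the radius
    jumps, and up to t0 the clipping has exactly the radius rad 0. *)
Definition truncate (t0 : R) (rad : nat -> R) (F : (R -> R) -> R -> R) u t :=
  F (clip (rad (stage t0 t)) \o u) t.

(** Only the stages up to stage t0 b matter on [a, b], so local integrability and
    continuity reduce to finite sums over stages. *)
Lemma truncate_causal (t0 : R) (rad : nat -> R) F (Q : nat -> R -> R) :
  cont_operator F -> volterra F -> (forall k, 0 <= rad k) ->
  (forall k, locint (Q k)) ->
  (forall k (u : R -> R), continuous u ->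
     {ae mu, forall t : R, `|F (clip (rad k) \o u) t| <= Q k t}) ->
  causal_operator (truncate t0 rad F) (fun t => Q (stage t0 t) t).
Proof.
move=> cF VF rad0 iQ FQ.
have iF k (u : R -> R) (cu : continuous u) :=
  cont_operator_locint cF (clip_comp_continuous (r := rad k) cu).
have iT (u : R -> R) : continuous u -> locint (truncate t0 rad F u).
  move=> cu; apply: (locint_piecewise t0 (H := fun k => F (clip (rad k) \o u))) => k.
  exact: iF.
split => //.
- move=> u cu a b e e0.
  pose D k (v : R -> R) t := `|F (clip (rad k) \o v) t - F (clip (rad k) \o u) t|.
  have iD k (v : R -> R) : continuous v -> locint (D k v).
    by move=> cv; apply/locint_norm/locintB; exact: iF.
  have H n e' : 0 < e' -> exists c d r, 0 < r /\ forall v : R -> R, continuous v ->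
      (forall t, c <= t <= d -> `|v t - u t| < r) ->
      Int a b (fun t => \sum_(k < n) D k v t) < e'.
    elim: n e' => [|n IH] e' e'0.
      exists 0, 0, 1; split => // v cv _; rewrite (@Int_eq _ _ _ _ (cst 0)).
        have [ab|ba] := leP a b; last by rewrite IntE0.
        by rewrite Int_cst// mul0r.
      by move=> t _; rewrite big_ord0.
    have e2 : 0 < e' / 2 by rewrite divr_gt0.
    have [c [d [r [r0 Hr]]]] := IH _ e2.
    have [c' [d' [r' [r'0 Hr']]]] := cF.2 _ (clip_comp_continuous (r := rad n) cu) a b _ e2.
    exists (Num.min c c'), (Num.max d d'), (Num.min r r'); split.
      by rewrite lt_min r0.
    move=> v cv vu.
    rewrite (@Int_eq _ _ _ _ (fun t => \sum_(k < n) D k v t + D n v t)); last first.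
      by move=> t _; rewrite big_ord_recr.
    rewrite IntD; last 2 first.
    - by apply: (locint_sum n (H := fun k => D k v)) => k; exact: iD.
    - exact: iD.
    rewrite [ltRHS]splitr ltrD//.
      apply: Hr => // t /andP[ct td]; have : `|v t - u t| < Num.min r r'.
        by apply: vu; rewrite ge_min ct le_max td.
      by rewrite lt_min => /andP[].
    apply: Hr'; first exact: clip_comp_continuous.
    move=> t /andP[ct td]; have : `|v t - u t| < Num.min r r'.
      by apply: vu; rewrite ge_min ct le_max td !orbT.
    by rewrite lt_min => /andP[_]; apply: le_lt_trans; exact: clip_lipschitz1.
  have [c [d [r [r0 Hr]]]] := H (stage t0 b).+1 e e0.
  exists c, d, r; split => // v cv vu; apply: le_lt_trans (Hr v cv vu).
  apply: Int_le_ae; first by apply/locint_norm/locintB; exact: iT.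
    by apply: (locint_sum _ (H := fun k => D k v)) => k; exact: iD.
  apply: aeT => t /andP[_ tb].
  have tN : (stage t0 t < (stage t0 b).+1)%N.
    by rewrite ltnS stage_le; apply: le_trans tb _; rewrite -stage_le.
  rewrite (bigD1 (Ordinal tN)) //=; apply: (@le_trans _ _ (D (stage t0 t) v t)) => //.
  by rewrite lerDl; apply: sumr_ge0 => i _; exact: normr_ge0.
- move=> z u v cu cv uv.
  have : {ae mu, forall t : R, forall k, t <= z ->
      F (clip (rad k) \o u) t = F (clip (rad k) \o v) t}.
    apply: ae_forall_nat => k; apply: VF; try exact: clip_comp_continuous.
    by move=> t /uv /= ->.
  by apply: filterS => t H; exact: H.
- move=> u cu; have : {ae mu, forall t : R, forall k, `|F (clip (rad k) \o u) t| <= Q k t}.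
    by apply: ae_forall_nat => k; exact: FQ.
  by apply: filterS => t H; exact: H.
Qed.

End Truncation.

(** * A priori bound for growth *)

Section Growth.
Set Implicit Arguments.
Unset Strict Implicit.
Context {R : realType}.
Local Notation mu := (@completed_lebesgue_measure R).

(** The supremum of the times in [a, t] at which u <= 0, or a if there is none. *)
Lemma last_nonpos (u : R -> R) (a t : R) : continuous u -> a <= t -> 0 < u t ->
  exists s, [/\ a <= s <= t, forall x, s < x -> x <= t -> 0 < u x &
    s = a \/ u s <= 0].
Proof.
move=> cu at_ ut; pose E := [set x | a <= x <= t /\ u x <= 0].
have [[x0 Ex0]|] := pselect (E !=set0); last first.
  move=> nE; exists a; split; [by rewrite lexx| |by left].
  move=> x ax xt; rewrite ltNge; apply/negP => ux; apply: nE; exists x; split => //.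
  by rewrite xt ltW.
have hE : has_sup E by split; [exists x0|exists t => x [/andP[]]].
have ubE : ubound E (sup E) by apply: sup_upper_bound.
have aE : a <= sup E by apply: le_trans (ubE _ Ex0); have [/andP[]] := Ex0.
have Et : sup E <= t by apply: ge_sup; [exists x0|move=> x [/andP[]]].
exists (sup E); split; first by rewrite aE.
  move=> x Ex xt; rewrite ltNge; apply/negP => ux.
  have : x <= sup E by apply: ubE; split => //; rewrite xt (le_trans aE (ltW Ex)).
  by rewrite leNgt Ex.
right; rewrite leNgt; apply/negP => us.
have /cvgrPdist_lt /(_ _ us) [d d0 Hd] := cu (sup E).
have [x [/andP[ax xt] ux] dx] := sup_adherent d0 hE.
have xE : x <= sup E by apply: ubE; split => //; rewrite ax.
have xd : `|sup E - x| < d by rewrite ger0_norm ?subr_ge0//; move: dx; lra.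
by have := Hd x xd; rewrite /= ltr_norml; lra.
Qed.

(** A bound on G x * sg (u x) only controls u' where it points away from 0. This is
    enough: integrate from the last time before t at which u had the opposite
    sign, where u is 0, or from a. *)
Lemma one_sided_growth (u G k : R -> R) (a b A : R) : continuous u -> locint G ->
  (forall s t, s <= t -> u t - u s = Int s t G) ->
  locint k -> (forall t, 0 <= k t) -> `|u a| <= A ->
  {ae mu, forall x : R, a <= x <= b -> G x * Num.sg (u x) <= k x} ->
  forall t, a <= t <= b -> `|u t| <= A + Int a b k.
Proof.
move=> cu iG uG ik k0 uA Gk t /andP[at_ tb].
have A0 : 0 <= A by exact: le_trans uA.
have Ik s : a <= s -> Int s t k <= Int a b k by move=> as_; exact: Int_mono.
have I0 : 0 <= Int a b k by exact: Int_ge0.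
have [ut|ut|_] := ltrgt0P (u t); last by rewrite addr_ge0.
- have [s [/andP[as_ st] us sA]] := last_nonpos cu at_ ut.
  have usA : u s <= A.
    by case: sA => [->|/le_trans]; [exact: le_trans (ler_norm _) uA|exact].
  rewrite -(subrK (u s) (u t)) uG// addrC lerD//.
  apply: le_trans (Ik s as_); apply: Int_le_ae => //.
  apply: filterS2 (ae_neq s) Gk => x xs H /andP[sx xt].
  have sx' : s < x by rewrite lt_neqAle sx andbT; apply/eqP => e; apply: xs.
  by have := H; rewrite (le_trans as_ sx) (le_trans xt tb) gtr0_sg ?us// mulr1; apply.
- have cN : continuous (fun x => - u x) by move=> x; apply: cvgN; exact: cu.
  have Nut : 0 < - u t by rewrite oppr_gt0.
  have [s [/andP[as_ st] us sA]] := last_nonpos cN at_ Nut.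
  have usA : - u s <= A.
    case: sA => [->|/le_trans]; last by apply.
    by apply: le_trans uA; rewrite -normrN ler_norm.
  have -> : - u t = - u s + - 1 * Int s t G by rewrite -uG//; lra.
  rewrite lerD// -IntZ//; apply: le_trans (Ik s as_); apply: Int_le_ae => //.
    exact: locintZ.
  apply: filterS2 (ae_neq s) Gk => x xs H /andP[sx xt].
  have sx' : s < x by rewrite lt_neqAle sx andbT; apply/eqP => e; apply: xs.
  have := H; rewrite (le_trans as_ sx) (le_trans xt tb) ltr0_sg -?oppr_gt0 ?us//.
  by rewrite mulrN1 mulN1r; apply.
Qed.

(** With B the supremum of |u| up to b, the previous lemma gives
    B <= A + B / 2 + int_a^b k on an interval over which w has integral at most 1/2. *)
Lemma growth_step (u G w k : R -> R) (a b A : R) : continuous u -> locint G ->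
  (forall s t, s <= t -> u t - u s = Int s t G) ->
  locint w -> (forall t, 0 <= w t) -> locint k -> (forall t, 0 <= k t) ->
  a <= b -> Int a b w <= 1 / 2 ->
  (forall t, t <= a -> `|u t| <= A) ->
  (forall B, (forall t, t <= b -> `|u t| <= B) ->
    {ae mu, forall x : R, a <= x <= b -> G x * Num.sg (u x) <= B * w x + k x}) ->
  forall t, t <= b -> `|u t| <= 2 * (A + Int a b k).
Proof.
move=> cu iG uG iw w0 ik k0 ab Iw uA H.
have cNu : {within `[a, b], continuous (fun x => `|u x|)}.
  by apply: continuous_subspaceT => x; apply: cvg_norm; exact: cu.
have [m mab um] := EVT_max ab cNu.
pose B := Num.max A `|u m|.
have uB t : t <= b -> `|u t| <= B.
  move=> tb; rewrite /B le_max; have [ta|at_] := leP t a; first by rewrite uA.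
  by rewrite um ?orbT// in_itv /= tb ltW.
have B0 : 0 <= B by rewrite le_max normr_ge0 orbT.
have I0 : 0 <= Int a b k by exact: Int_ge0.
have := one_sided_growth cu iG uG _ _ (uA a (lexx a)) (H B uB).
move=> /(_ (locintD (locintZ B iw) ik)) K.
have {}K : forall t, a <= t <= b -> `|u t| <= A + (B / 2 + Int a b k).
  move=> t tab; apply: le_trans (K _ t tab) _.
    by move=> x; rewrite addr_ge0// mulr_ge0.
  rewrite lerD2l IntD//; last exact: locintZ.
  rewrite IntZ// lerD2r ler_wpM2l//; lra.
have BE : B <= 2 * (A + Int a b k).
  have A0 : 0 <= A by exact: le_trans (uA a (lexx a)).
  rewrite /B ge_max; apply/andP; split; first by lra.
  move: mab; rewrite in_itv /= => /K.
  rewrite /B; case: (leP A `|u m|) => h; lra.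
by move=> t /uB /le_trans; apply.
Qed.

(** A form of the lemma of Gronwall: [growth_step] on K short intervals that cover
    [t0, b]. The constant E depends on w, t0 and b only, so that the radius of the
    truncation can be chosen before the solution is known. *)
Lemma growth_bound (w : R -> R) (t0 b : R) : locint w -> (forall t, 0 <= w t) ->
  t0 <= b -> exists2 E : R, 0 < E & forall (u G k : R -> R) (A : R),
  continuous u -> locint G -> (forall s t, s <= t -> u t - u s = Int s t G) ->
  locint k -> (forall t, 0 <= k t) ->
  (forall t, t <= t0 -> `|u t| <= A) ->
  (forall c B, c <= b -> (forall t, t <= c -> `|u t| <= B) ->
    {ae mu, forall x : R, t0 <= x <= c -> G x * Num.sg (u x) <= B * w x + k x}) ->
  forall t, t <= b -> `|u t| <= E * (A + Int t0 b k).
Proof.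
move=> iw w0 t0b.
have c0 : 0 < 1 / 2 :> R by rewrite divr_gt0.
have [d d0 Hd] := Int_small_ge0 t0 b iw w0 c0.
have d2 : 0 < d / 2 by rewrite divr_gt0.
pose K := Num.bound ((b - t0) / (d / 2)).
exists (2 ^+ K.+1); first by rewrite exprn_gt0.
move=> u G k A cu iG uG ik k0 uA H.
pose Q := Int t0 b k; have Q0 : 0 <= Q by exact: Int_ge0.
pose T j : R := Num.min (t0 + j%:R * (d / 2)) b.
have t0T j : t0 <= T j by rewrite le_min t0b andbT lerDl mulr_ge0// ltW.
have Tb j : T j <= b by rewrite ge_min lexx orbT.
have step j t : t <= T j -> `|u t| <= 2 ^+ j.+1 * (A + Q) - 2 * Q.
  elim: j t => [|j IH] t.
    rewrite /T mul0r addr0 min_l// => /uA; rewrite expr1.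
    by have := normr_ge0 (u t); lra.
  have TT : T j <= T j.+1.
    by apply: le_min2 => //; rewrite lerD2l ler_wpM2r ?(ltW d2)// ler_nat.
  have IT : Int (T j) (T j.+1) w <= 1 / 2.
    apply/ltW/Hd => //.
    apply: le_lt_trans (ler_norm _) (le_lt_trans (minr_lipschitz1 _ _ _) _).
    rewrite -natr1 mulrDl mul1r opprD addrACA subrr add0r addrAC subrr add0r.
    by rewrite gtr0_norm//; lra.
  have HT B : (forall t, t <= T j.+1 -> `|u t| <= B) ->
    {ae mu, forall x : R, T j <= x <= T j.+1 -> G x * Num.sg (u x) <= B * w x + k x}.
    move=> uB; apply: filterS (H _ B (Tb j.+1) uB) => x Hx /andP[x1 x2]; apply: Hx.
    by rewrite x2 (le_trans _ x1).
  move=> tT; apply: le_trans (growth_step cu iG uG iw w0 ik k0 TT IT IH HT tT) _.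
  have : Int (T j) (T j.+1) k <= Q by exact: Int_mono.
  rewrite (exprS _ j.+1); set P := 2 ^+ _ * (A + Q); rewrite -mulrA -/P; lra.
move=> t tb; have TK : T K = b.
  rewrite /T min_r// -lerBlDl -ler_pdivrMr//; apply/ltW/archi_boundP.
  by rewrite divr_ge0 ?subr_ge0// ltW.
have := step K t; rewrite TK => /(_ tb) /le_trans; apply.
by rewrite -/Q lerBlDr lerDl mulr_ge0.
Qed.

End Growth.

(** * The truncated equation *)

Section SupNorm.
Set Implicit Arguments.
Unset Strict Implicit.
Context {R : realType}.
Implicit Types (v : R -> R) (M t : R).

Lemma bounded_fun_norm v M : (forall t, `|v t| <= M) -> bounded_fun v.
Proof.
move=> H; exists M; split; rewrite ?num_real// => x Mx t _.
exact: le_trans (H t) (ltW Mx).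
Qed.

Lemma supnorm_le v M : (forall t, `|v t| <= M) -> supnorm v <= M.
Proof.
move=> H; apply: ge_sup; first by exists `|v 0|; exists 0.
by move=> _ [t _ <-].
Qed.

Lemma le_supnorm v M t : (forall t, `|v t| <= M) -> `|v t| <= supnorm v.
Proof.
move=> H; apply: sup_upper_bound; last by exists t.
by split; [exists `|v 0|; exists 0|exists M => _ [x _ <-]].
Qed.

End SupNorm.

Section Equation.
Set Implicit Arguments.
Unset Strict Implicit.
Context {R : realType}.
Local Notation mu := (@completed_lebesgue_measure R).
Variables (l0 l1 f : (R -> R) -> R -> R) (t0 kappa : R).
Variables (q : R -> R -> R) (g h0 : R -> R).
Hypotheses (l0_lin : linear_operator l0) (l0_cont : cont_operator l0)
  (l0_pos : positive_operator l0) (l0_V : volterra l0).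
Hypotheses (l1_lin : linear_operator l1) (l1_cont : cont_operator l1)
  (l1_pos : positive_operator l1) (l1_V : volterra l1).
Hypotheses (f_cont : cont_operator f) (f_car : local_Caratheodory f)
  (f_V : volterra f).
Hypothesis kappa_gt0 : 0 < kappa.

Definition rhs (u : R -> R) (t : R) : R := l0 u t - l1 u t + f u t.

Lemma rhs_cont : cont_operator rhs.
Proof.
exact: (cont_operatorD (cont_operatorD l0_cont (cont_operatorN l1_cont)) f_cont).
Qed.

Lemma rhs_V : volterra rhs.
Proof.
move=> z u v cu cv uv.
apply: filterS3 (l0_V cu cv uv) (l1_V cu cv uv) (f_V cu cv uv) => t H0 H1 H2 tz.
by rewrite /rhs H0// H1// H2.
Qed.

Let one := cst 1 : R -> R.
Let c1 : continuous one. Proof. by move=> x; exact: cvg_cst. Qed.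

Definition weight (t : R) : R := `|l0 one t| + `|l1 one t|.

Lemma weight_locint : locint weight.
Proof. by apply: locintD; apply: locint_norm; exact: cont_operator_locint. Qed.

Lemma weight_ge0 t : 0 <= weight t. Proof. by rewrite addr_ge0. Qed.

Lemma linear_part_bound (tau m : R) (v : R -> R) : continuous v ->
  (forall t, t <= tau -> `|v t| <= m) ->
  {ae mu, forall t : R, t <= tau -> `|l0 v t| + `|l1 v t| <= m * weight t}.
Proof.
move=> cv vm.
have m0 : 0 <= m by apply: le_trans (normr_ge0 _) (vm tau (lexx _)).
apply: filterS2 (positive_operator_norm l0_lin l0_pos l0_V cv vm)
  (positive_operator_norm l1_lin l1_pos l1_V cv vm) => t H0 H1 tt.
rewrite /weight mulrDr lerD//.
  by apply: le_trans (H0 tt) _; rewrite ler_wpM2l// ler_norm.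
by apply: le_trans (H1 tt) _; rewrite ler_wpM2l// ler_norm.
Qed.

Lemma rhs_clip_bound r : 0 < r -> exists Q : R -> R, [/\ locint Q,
  forall t, 0 <= Q t & forall u : R -> R, continuous u ->
  {ae mu, forall t : R, `|rhs (clip r \o u) t| <= Q t}].
Proof.
move=> r0; have [qr [qr0 iqr] Hqr] := f_car r0.
exists (fun t => r * weight t + qr t); split.
- apply: locintD; first exact: locintZ weight_locint.
  by move=> a b; exact: iqr.
- move=> t; rewrite addr_ge0// ?mulr_ge0 ?(ltW r0) ?weight_ge0//.
  by have := qr0 t I; rewrite /= in_itv /= andbT.
move=> u cu; set v := clip r \o u.
have cv : continuous v by exact: clip_comp_continuous.
have vr t : `|v t| <= r by apply: norm_clip_le; exact: ltW.
have hl : {ae mu, forall t : R, forall n : nat, t <= n%:R ->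
    `|l0 v t| + `|l1 v t| <= r * weight t}.
  by apply: ae_forall_nat => n; apply: linear_part_bound.
have hf := Hqr v (And3 cv (bounded_fun_norm vr) (fun t => I)) (supnorm_le vr).
apply: filterS2 hl hf => t /(_ (Num.bound t)) h1 h2.
have {}h1 := h1 (le_trans (ler_norm t) (ltW _)).
apply: le_trans (ler_normD _ _) _; rewrite lerD//.
apply: le_trans (ler_normB _ _) _; apply: h1.
by have := archi_boundP (normr_ge0 t); rewrite /Num.bound normr_id.
Qed.

Section Solution.
Variables (rad : nat -> R).
Hypothesis rad_gt0 : forall k, 0 < rad k.
Hypothesis rad0 : rad 0%N = kappa.

Local Notation Ftr := (truncate t0 rad rhs).

Lemma truncate_le_t0 u t : t <= t0 -> Ftr u t = rhs (clip kappa \o u) t.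
Proof.
move=> tt0; rewrite /truncate.
have -> : stage t0 t = 0%N by apply/eqP; rewrite -leqn0 stage_le addr0.
by rewrite rad0.
Qed.

(** Up to t0 the truncated right-hand side is that of the equation for the function
    clipped to radius kappa. If u is nondecreasing and nonnegative there, the
    clipped function is so too and has values in [0, kappa]; hence the hypotheses
    on l0 - l1 and on f apply and [causal_existence] can be used. *)
Lemma truncated_solution (c : R) :
  Pplus t0 (fun u t => l0 u t - l1 u t) ->
  {ae mu, forall t : R, t <= t0 -> f (fun _ => 0) t = 0} ->
  (forall v : R -> R, C0 `[0, kappa] v -> {ae mu, forall t : R, t <= t0 -> 0 <= f v t}) ->
  0 <= c -> exists u : R -> R, [/\
    [/\ continuous u, locint (Ftr u),
     forall s t, s <= t -> u t - u s = Int s t (Ftr u) & u t0 = c],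
    forall s t, s <= t -> t <= t0 -> u s <= u t,
    forall t, t <= t0 -> 0 <= u t &
    {ae mu, forall t : R, t <= t0 -> 0 <= Ftr u t}].
Proof.
move=> [_ _ l01_P] f0 f_ge0 c_ge0.
have /choice [Q HQ] (k : nat) := rhs_clip_bound (rad_gt0 k).
have iQ k : locint (Q k) by have [] := HQ k.
have Q0 k t : 0 <= Q k t by have [] := HQ k.
have causalF : causal_operator Ftr (fun t => Q (stage t0 t) t).
  apply: truncate_causal => //; first exact: rhs_cont.
  - exact: rhs_V.
  - by move=> k; exact: ltW.
  - by move=> k; have [] := HQ k.
have iQs := locint_piecewise t0 iQ.
have F_zero : {ae mu, forall t : R, t <= t0 -> Ftr (fun _ => 0) t = 0}.
  apply: filterS3 (linear_operator0 l0_lin) (linear_operator0 l1_lin) f0 => t E0 E1 E2 tt0.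
  rewrite truncate_le_t0// (_ : clip kappa \o _ = fun _ => 0).
    by rewrite /rhs E0 E1 E2// subrr addr0.
  by apply/funext => x /=; rewrite clip0// ltW.
have F_ge0 (u : R -> R) : continuous u -> (forall a b, abs_cont a b u) ->
  (forall s t, s <= t -> t <= t0 -> u s <= u t) ->
  (forall t, t <= t0 -> 0 <= u t) -> {ae mu, forall t : R, t <= t0 -> 0 <= Ftr u t}.
  move=> cu ac mono u0; set v := clip kappa \o u.
  have cv : continuous v by exact: clip_comp_continuous.
  have v0 t : t <= t0 -> 0 <= v t.
    by move=> tt0; apply: clip_ge0; [exact: ltW|exact: u0].
  have h1 : ACloc `]-oo, t0] `[0, +oo[ v.
    split; last by move=> a b _; exact: abs_cont_clip.
    by move=> t /=; rewrite !in_itv /= andbT => /v0.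
  have h2 s t : s <= t -> t <= t0 -> v s <= v t.
    by move=> st tt0; apply: clip_mono; exact: mono.
  have h3 : C0 `[0, kappa] (theta_left t0 v).
    split; first exact: theta_left_continuous.
      by apply: (@bounded_fun_norm _ _ kappa) => t; apply: norm_clip_le; exact: ltW.
    move=> t; rewrite /= in_itv /= v0 ?ge_min ?lexx ?orbT//=.
    by apply: le_trans (ler_norm _) _; apply: norm_clip_le; exact: ltW.
  have V0 := volterra_theta t0 l0_V cv; have V1 := volterra_theta t0 l1_V cv.
  have Vf := volterra_theta t0 f_V cv.
  have L : {ae mu, forall t : R, t <= t0 -> 0 <= l0 v t - l1 v t}.
    apply: filterS3 V0 V1 (l01_P v h1 h2) => t E0 E1 H tt0.
    by rewrite E0// E1// H.
  apply: filterS3 L Vf (f_ge0 _ h3) => t H1 E H2 tt0.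
  by rewrite truncate_le_t0// /rhs addr_ge0 ?H1// E// H2.
have Q0' t : 0 <= Q (stage t0 t) t by [].
have [u [cu uF uc mono u0]] := causal_existence causalF iQs Q0' F_zero F_ge0 c_ge0.
have iF := causal_locint causalF cu.
exists u; split => //; apply: F_ge0 => // a b.
apply: (@abs_cont_primitive _ a b 0 u (fun t => `|Ftr u t|)) => //.
  exact: locint_norm.
by move=> s t st; rewrite !subr0 uF//; exact: le_norm_Int.
Qed.

(** Up to time t the values of u are at most u t, so that there |l0 u| + |l1 u| is at
    most u t * weight and f u at most g * h0 (u t); integrated from s to t, this is
    the inequality that [osgood_positive] needs. *)
Lemma truncated_solution_positive (u : R -> R) :
  continuous u -> locint (Ftr u) ->
  (forall s t, s <= t -> u t - u s = Int s t (Ftr u)) ->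
  (forall s t, s <= t -> t <= t0 -> u s <= u t) ->
  (forall t, t <= t0 -> 0 <= u t) -> 0 < u t0 <= kappa ->
  Lloc setT `[0, +oo[ g ->
  (forall x : R, 0 < x -> 0 < h0 x) -> {within `]0, +oo[, continuous h0} ->
  (forall x y : R, 0 < x -> x <= y -> h0 x <= h0 y) ->
  (forall v : R -> R, C0 `[0, kappa] v -> (exists t : R, v t <> 0) ->
     {ae mu, forall t : R, t <= t0 -> f v t <= g t * h0 (supnorm v)}) ->
  \int[mu]_(s in `[x, 1]) (h0 s)^-1 @[x --> 0^'+] --> +oo ->
  forall t, t <= t0 -> 0 < u t.
Proof.
move=> cu iF uF mono u0 /andP[ut0 utk] gL h0_gt0 h0_cont h0_mono f_le h0_int.
have ig := Lloc_locint gL.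
have g0 t : 0 <= g t by have := gL.1 t I; rewrite /= in_itv /= andbT.
pose w t := weight t + g t.
have iw : locint w by apply: locintD => //; exact: weight_locint.
have w0 t : 0 <= w t by rewrite addr_ge0// weight_ge0.
apply: (osgood_positive iw w0 cu mono u0 ut0 h0_gt0 h0_cont h0_mono h0_int).
move=> s t st tt0 ut.
have uE x : x <= t0 -> (clip kappa \o u) x = u x.
  by move=> xt0; rewrite /= clip_id// ger0_norm ?u0// (le_trans _ utk)// mono.
have ut1 x : x <= t -> `|u x| <= u t.
  by move=> xt; rewrite ger0_norm ?u0 ?mono// (le_trans xt).
pose v := theta_left t u.
have cv : continuous v by exact: theta_left_continuous.
have vt x : `|v x| <= u t by apply: ut1; rewrite ge_min lexx orbT.
have hv : C0 `[0, kappa] v.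
  split => //; first exact: bounded_fun_norm vt.
  move=> x; rewrite /= in_itv /= u0 ?(le_trans (ler_norm _) (le_trans (vt x) _))//.
    by rewrite (le_trans _ utk)// mono.
  by rewrite ge_min tt0 orbT.
have vtE : v t = u t by rewrite /v theta_leftE.
have vn0 : exists x, v x <> 0 by exists t; rewrite vtE; apply/eqP; rewrite gt_eqF.
have sv_le : supnorm v <= u t := supnorm_le vt.
have sv_gt0 : 0 < supnorm v.
  by apply: lt_le_trans (le_supnorm t vt); rewrite vtE normr_gt0 gt_eqF.
rewrite uF// -IntZ//; apply: Int_le_ae => //; first exact: locintZ.
have E := rhs_V (clip_comp_continuous (r := kappa) cu) cu uE.
have fb : {ae mu, forall x : R, x <= t -> f u x <= g x * h0 (u t)}.
  apply: filterS2 (volterra_theta t f_V cu) (f_le v hv vn0) => x E' H xt.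
  rewrite E'// (le_trans (H (le_trans xt tt0)))// ler_wpM2l//; exact: h0_mono.
have lb := linear_part_bound cu ut1.
apply: filterS3 E fb lb => x Ex fx lx /andP[_ xt].
have xt0 := le_trans xt tt0.
rewrite truncate_le_t0// Ex// /rhs; apply: le_trans (lerD _ (fx xt)) _.
  exact: le_trans (ler_norm _) (le_trans (ler_normB _ _) (lx xt)).
rewrite /w; have hu := h0_gt0 _ ut; have wx := weight_ge0 x; have gx := g0 x.
have := mulr_ge0 (ltW hu) wx; have := mulr_ge0 (ltW ut) gx.
rewrite mulrDl !mulrDr; lra.
Qed.

(** Extended by 0 to the left of t0, where q is not controlled. *)
Definition qpos (M : R) : R -> R := q^~ M \_ `[t0, +oo[.

Lemma qpos_locint M : Kloc t0 q -> 0 <= M -> locint (qpos M).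
Proof.
move=> [_ _ _ Kq] M0 a b; apply: (@integrable_restrict_setI _
  (caratheodory_type (wlength (R:=R) idfun)^*%mu) R mu).
- exact: measurable_itv_completed.
- exact: measurable_itv_completed.
rewrite (_ : _ `&` _ = `[Num.max a t0, b]%classic); last first.
  apply/seteqP; split => x /=; rewrite !in_itv /= ge_max andbT.
    by move=> [/andP[-> ->] ->].
  by move=> /andP[/andP[-> ->] ->].
have MD : [set M] `<=` `[0, +oo[ by move=> _ ->; rewrite /= in_itv /= M0.
have at0 : t0 <= Num.max a t0 by rewrite le_max lexx orbT.
have := Kq [set M] (@compact_set1 _ M) (ex_intro _ M erefl) MD (Num.max a t0) b at0.
congr (_.-integrable _ _); apply/funext => x /=.
by rewrite image_set1 ereal_sup1.
Qed.

Lemma Int_qpos M b : Int t0 b (qpos M) = \int[mu]_(s in `[t0, b]) q s M.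
Proof.
apply: Int_eq => x /andP[h _]; rewrite /qpos patchE mem_set//.
by rewrite /= in_itv /= h.
Qed.

(** Clipping preserves the sign and does not increase the absolute value, so the
    one-sided bound on f holds along the clipped function, with the bound M for u
    itself and whatever the radius is. *)
Lemma truncated_solution_bound (u : R -> R) (b M : R) :
  (forall t x y : R, t0 <= t -> 0 <= x -> x <= y -> q t x <= q t y) ->
  (forall v : R -> R, C0 setT v -> 0 <= v t0 <= kappa ->
     (forall t, t <= t0 -> - kappa <= v t <= kappa) ->
     {ae mu, forall t : R, t0 <= t -> f v t * Num.sg (v t) <= q t (supnorm v)}) ->
  continuous u -> t0 <= b ->
  (forall t, t <= t0 -> `|u t| <= kappa) -> 0 <= u t0 ->
  (forall t, t <= b -> `|u t| <= M) ->
  forall c B, c <= b -> (forall t, t <= c -> `|u t| <= B) ->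
    {ae mu, forall x : R, t0 <= x <= c ->
       Ftr u x * Num.sg (u x) <= B * weight x + qpos M x}.
Proof.
move=> q_nondecr f_sgn cu t0b uk ut0 uM c B cb uB.
have H k : {ae mu, forall x : R, t0 <= x <= c ->
    rhs (clip (rad k) \o u) x * Num.sg (u x) <= B * weight x + qpos M x}.
  have r0 := rad_gt0 k; set v := clip (rad k) \o u.
  have cv : continuous v by exact: clip_comp_continuous.
  have vu x : `|v x| <= `|u x| by apply: norm_clip_le_norm; exact: ltW.
  pose th := theta_left b v.
  have thM x : `|th x| <= M.
    by apply: le_trans (vu _) (uM _ _); rewrite ge_min lexx orbT.
  have cth : continuous th by exact: theta_left_continuous.
  have th_lo x : x <= t0 -> th x = v x.
    by move=> xt; rewrite /th theta_leftE// (le_trans xt).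
  have h1 : 0 <= th t0 <= kappa.
    rewrite th_lo// clip_ge0 ?(ltW r0)//=.
    exact: le_trans (ler_norm _) (le_trans (vu _) (uk _ (lexx _))).
  have h2 x : x <= t0 -> - kappa <= th x <= kappa.
    by move=> xt; rewrite -ler_norml th_lo// (le_trans (vu x))// uk.
  have hs := f_sgn th (And3 cth (bounded_fun_norm thM) (fun _ => I)) h1 h2.
  have lb : {ae mu, forall t : R, t <= c -> `|l0 v t| + `|l1 v t| <= B * weight t}.
    by apply: linear_part_bound => // x xc; exact: le_trans (vu x) (uB x xc).
  apply: filterS3 (volterra_theta b f_V cv) hs lb => x Ef Hs Hl /andP[t0x xc].
  have xb := le_trans xc cb.
  have := Hs t0x; rewrite -/th -Ef// /th theta_leftE// sgr_clip// => Hq.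
  have Sg : `|Num.sg (u x)| <= 1 by rewrite normr_sg lern1; case: (u x != 0).
  rewrite /rhs mulrDl lerD//.
    apply: le_trans (ler_norm _) _; rewrite normrM.
    apply: le_trans (ler_pM _ _ (ler_normB _ _) Sg) _ => //.
    by rewrite mulr1; exact: Hl.
  apply: le_trans Hq _; rewrite /qpos patchE mem_set; last by rewrite /= in_itv /= t0x.
  apply: q_nondecr => //; last exact: supnorm_le.
  exact: le_trans (normr_ge0 _) (le_supnorm x thM).
by have := ae_forall_nat H; apply: filterS => x Hx; exact: Hx.
Qed.

End Solution.

(** Sublinear growth of the integral of q: no M above rho can satisfy the bound
    M <= E * (kappa + int q(., M)) of [growth_bound]. *)
Lemma bound_radius (E b : R) : 0 < E -> t0 < b ->
  x^-1 * (\int[mu]_(s in `[t0, b]) q s x) @[x --> +oo] --> 0 ->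
  exists2 rho : R, kappa < rho &
    forall M : R, rho <= M -> E * (kappa + Int t0 b (qpos M)) < M.
Proof.
move=> E0 t0b /cvgrPdist_lt /(_ (2 * E)^-1) [|X [_ HX]].
  by rewrite invr_gt0 mulr_gt0.
exists (Num.max (X + 1) (2 * E * kappa + kappa + 1)).
  by rewrite lt_max; apply/orP; right; have := mulr_gt0 E0 kappa_gt0; rewrite -mulrA; lra.
move=> M; rewrite ge_max => /andP[XM kM].
have Ek := mulr_gt0 E0 kappa_gt0.
have k0 := kappa_gt0.
have M0 : 0 < M by move: kM; rewrite -mulrA; lra.
have XM' : X < M by lra.
have := HX M XM'; rewrite /= sub0r normrN -Int_qpos.
move=> /(le_lt_trans (ler_norm _)); rewrite ltr_pdivrMl// => K.
have : E * Int t0 b (qpos M) < E * (M / (2 * E)) by rewrite ltr_pM2l.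
have -> : E * (M / (2 * E)) = M / 2 by field; rewrite gt_eqF.
by move: kM; rewrite -mulrA mulrDr; lra.
Qed.

End Equation.

(** * Existence of a global solution *)

Theorem theorem2p4 (R : realType)
  (l0 l1 f : (R -> R) -> R -> R) (t0 kappa : R)
  (q : R -> R -> R) (g h0 : R -> R)
  (l0_lin : linear_operator l0) (l0_cont : cont_operator l0)
  (l0_pos : positive_operator l0)
  (l1_lin : linear_operator l1) (l1_cont : cont_operator l1)
  (l1_pos : positive_operator l1)
  (f_cont : cont_operator f) (f_car : local_Caratheodory f)
  (l0_V : V l0) (l1_V : V l1) (f_V : V f)
  (l0l1_P : Pplus t0 (fun u t => l0 u t - l1 u t))
  (f0 : {ae @completed_lebesgue_measure R,
           forall t : R, t <= t0 -> f (fun _ => 0) t = 0})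
  (kappa_gt0 : 0 < kappa)
  (f_ge0 : forall v : R -> R, C0 `[0, kappa] v ->
     {ae @completed_lebesgue_measure R,
        forall t : R, t <= t0 -> 0 <= f v t})
  (q_K : Kloc t0 q)
  (q_nondecr : forall t x y : R, t0 <= t -> 0 <= x -> x <= y -> q t x <= q t y)
  (q_lim : forall b : R, t0 < b ->
     x^-1 * (\int[@completed_lebesgue_measure R]_(s in `[t0, b]) q s x)
       @[x --> +oo] --> 0)
  (f_sgn : forall v : R -> R, C0 setT v -> 0 <= v t0 <= kappa ->
     (forall t, t <= t0 -> - kappa <= v t <= kappa) ->
     {ae @completed_lebesgue_measure R,
        forall t : R, t0 <= t -> f v t * Num.sg (v t) <= q t (supnorm v)})
  (g_L : Lloc setT `[0, +oo[ g)
  (h0_gt0 : forall x : R, 0 < x -> 0 < h0 x)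
  (h0_cont : {within `]0, +oo[, continuous h0})
  (h0_nondecr : forall x y : R, 0 < x -> x <= y -> h0 x <= h0 y)
  (f_le : forall v : R -> R, C0 `[0, kappa] v -> (exists t : R, v t <> 0) ->
     {ae @completed_lebesgue_measure R,
        forall t : R, t <= t0 -> f v t <= g t * h0 (supnorm v)})
  (h0_int : \int[@completed_lebesgue_measure R]_(s in `[x, 1]) (h0 s)^-1
     @[x --> 0^'+] --> +oo) :
  forall c : R, 0 < c <= kappa ->
  exists u : R -> R,
    [/\ global_solution l0 l1 f u,
        u t0 = c,
        {ae @completed_lebesgue_measure R,
           forall t : R, t <= t0 -> 0 <= derive1 u t} &
        forall t, t <= t0 -> 0 < u t <= kappa].
Proof.
move=> c /andP[c0 ck].
have {}l0_V := V_volterra l0_V; have {}l1_V := V_volterra l1_V.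
have {}f_V := V_volterra f_V.
pose w := weight l0 l1.
have iw : locint w := weight_locint l0_cont l1_cont.
have w0 t : 0 <= w t := weight_ge0 l0 l1 t.
pose b (n : nat) : R := t0 + n.+1%:R.
have t0b n : t0 < b n by rewrite ltrDl ltr0n.
(* rho n is larger than sup |u| on ]-oo, b n] for every solution u of a truncated
   equation, whatever the radii; kappa < rho n ensures that a supremum above
   rho n is attained in [t0, b n]. *)
have radius (n : nat) : exists rho : R, kappa < rho /\
    forall (u G : R -> R) (M : R), continuous u -> locint G ->
      (forall s t, s <= t -> u t - u s = Int s t G) -> 0 <= M ->
      (forall t, t <= t0 -> `|u t| <= kappa) ->
      (forall c B, c <= b n -> (forall t, t <= c -> `|u t| <= B) ->
        {ae @completed_lebesgue_measure R, forall x : R, t0 <= x <= c ->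
          G x * Num.sg (u x) <= B * w x + qpos t0 q M x}) ->
      rho <= M -> forall t, t <= b n -> `|u t| < M.
  have [E E0 HE] := growth_bound iw w0 (ltW (t0b n)).
  have [rho kr Hrho] := bound_radius kappa_gt0 E0 (t0b n) (q_lim _ (t0b n)).
  exists rho; split => // u G M cu iG uG M0 uk H rM t tb.
  apply: le_lt_trans (Hrho _ rM).
  apply: (HE u G (qpos t0 q M) kappa) => //; first exact: qpos_locint.
  move=> x; rewrite /qpos patchE; case: ifPn => // /set_mem /=.
  by rewrite in_itv /= andbT => t0x; have [/(_ x M t0x M0)] := q_K.
have [rho Hrho] := choice radius.
pose rad (k : nat) := if k is n.+1 then rho n else kappa.
have rad_gt0 k : 0 < rad k.
  by case: k => //= n; apply: lt_trans kappa_gt0 _; have [] := Hrho n.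
have [u [[cu iF uF ut0] mono u0 F0]] := truncated_solution l0_lin l0_cont l0_pos l0_V
  l1_lin l1_cont l1_pos l1_V f_cont f_car f_V kappa_gt0 rad_gt0 erefl l0l1_P f0 f_ge0
  (ltW c0).
have uk t : t <= t0 -> `|u t| <= kappa.
  by move=> tt0; rewrite ger0_norm ?u0// (le_trans _ ck)// -ut0 mono.
have ut0k : 0 < u t0 <= kappa by rewrite ut0 c0.
have upos : forall t, t <= t0 -> 0 < u t.
  exact: (truncated_solution_positive l0_lin l0_cont l0_pos l0_V l1_lin l1_cont
    l1_pos l1_V f_V (erefl : rad 0%N = kappa) cu iF uF mono u0 ut0k g_L h0_gt0 h0_cont
    h0_nondecr f_le h0_int).
have ubound n t : t <= t0 + n%:R -> `|u t| <= rad n.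
  case: n => [|n]; first by rewrite addr0 => /uk.
  move=> tb; have cNu : {within `[t0, b n], continuous (fun x => `|u x|)}.
    by apply: continuous_subspaceT => x; apply: cvg_norm; exact: cu.
  have [m mab um] := EVT_max (ltW (t0b n)) cNu.
  pose M := Num.max kappa `|u m|.
  have uM x : x <= b n -> `|u x| <= M.
    move=> xb; rewrite le_max; have [xt|tx] := leP x t0; first by rewrite uk.
    by rewrite um ?orbT// in_itv /= xb ltW.
  have M0 : 0 <= M by rewrite le_max normr_ge0 orbT.
  have [kr H] := Hrho n.
  apply: le_trans (uM t tb) _; rewrite leNgt; apply/negP => rM.
  have Mm : M = `|u m|.
    rewrite /M; case: (leP kappa `|u m|) => // mk.
    by move: rM; rewrite /= /M max_l ?ltW// => /lt_trans /(_ kr); rewrite ltxx.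
  have mb : m <= b n by move: mab; rewrite in_itv /= => /andP[].
  have u00 : 0 <= u t0 by exact: u0.
  have := H u _ M cu iF uF M0 uk (truncated_solution_bound l0_lin l0_pos l0_V l1_lin
    l1_pos l1_V f_V rad_gt0 q_nondecr f_sgn cu (ltW (t0b n)) uk u00 uM) (ltW rM) m mb.
  by rewrite Mm ltxx.
(* Hence the clipping has no effect on u. *)
have FE : {ae @completed_lebesgue_measure R, forall t : R,
    truncate t0 rad (rhs l0 l1 f) u t = l0 u t - l1 u t + f u t}.
  have H (k : nat) : {ae @completed_lebesgue_measure R, forall t : R, t <= t0 + k%:R ->
      rhs l0 l1 f (clip (rad k) \o u) t = rhs l0 l1 f u t}.
    apply: rhs_V => //; first exact: clip_comp_continuous.
    by move=> t tk; rewrite /= clip_id// ubound.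
  apply: filterS (ae_forall_nat H) => t; apply.
  by rewrite -stage_le.
have du := ae_is_derive_primitive iF uF.
exists u; split.
- split; last first.
    by apply: filterS2 du FE => t Hd E; move: Hd; rewrite E.
  split => // a b' _.
  apply: (@abs_cont_primitive _ a b' 0 u
    (fun t => `|truncate t0 rad (rhs l0 l1 f) u t|)) => //.
    exact: locint_norm.
  by move=> s t st; rewrite !subr0 uF//; exact: le_norm_Int.
- exact: ut0.
- apply: filterS2 du F0 => t Hd H tt0; rewrite derive1E (@derive_val _ _ _ _ _ _ _ Hd).
  exact: H.
- by move=> t tt0; rewrite upos//= (le_trans (ler_norm _) (uk t tt0)).
Qed.
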